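(* Let $\mathcal M\models T$ be dense complete. Let $A\subseteq M^{m+n}$ be a bounded $\mathcal C^p$ cell, presented over the parameter coordinates so that every fiber $A_a$, $a\in A'=\Pi_m(A)$, has the same recursive cell form, and let $\lambda\in M^{>0}$ be such that every finite boundary function occurring in the recursive cell presentation of every fiber $A_a$ is $\lambda$-Lipschitz. Let $(a_i)_{i<\kappa}$ be a $\kappa$-sequence in $A'$, and suppose that $(A_{a_i})_{i<\kappa}$ is Cauchy with respect to the Hausdorff distance. Then there exists a $\lambda$-Lipschitz limit cell $B\subseteq M^n$ such that $(A_{a_i})_{i<\kappa}$ converges to $B$ in the Hausdorff sense.
   Context: $T$ is a complete o-minimal expansion of the theory of real closed fields in a language $\mathcal L$; ''definable'' means definable with parameters from $M$. $\mathcal M$ is dense complete if it has no proper elementary extension $\mathcal M'\models T$ in which $M$ is dense (equivalently, it equals its dense completion). $M^k$ carries the sup metric $d$. Cells: $p>0$ is an integer, $n\ge 1$. $\mathcal C^p$ cells are the usual o-minimal ones, built recursively as graphs $\Gamma(f)$ or open bands $(f,g)_U=\{(x,y):x\in U, f(x)<y<g(x)\}$ of definable $\mathcal C^p$ functions on cells $U$ of one dimension less. $\Pi_k$ is projection onto the first $k$ coordinates; $A_a=\{x\in M^n:(a,x)\in A\}$. ''Presented over the parameter coordinates'' means that for each $k<n$, $\Pi_{m+k+1}(A)$ is a graph or a band over $\Pi_{m+k}(A)$; the boundary functions of the fiber $A_a$ are the functions $h(a,-)$ on the fibers of $\Pi_{m+k}(A)$ over $a$, where $h$ is the graphing function or a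 lower/upper band function at that level. A function $h$ is $\lambda$-Lipschitz if $|h(x)-h(y)|\le\lambda\,d(x,y)$. $\lambda$-Lipschitz limit cells (not necessarily definable) are defined by induction on $n$. For $n=1$: a point, an interval, a ray, or $M$. For $n>1$: let $U\subseteq M^{n-1}$ be a $\lambda$-Lipschitz limit cell. If $f:U\to M$ is $\lambda$-Lipschitz then the graph $\Gamma(f)$ is a $\lambda$-Lipschitz limit cell; if $f,g:U\to M$ are $\lambda$-Lipschitz and $f\le g$, then $(f,g)^{\lim}_U:=\{(x,y)\in U\times M: f(x)\le y\le g(x)\}$ is a $\lambda$-Lipschitz limit cell. Let $\kappa$ be the least cardinality of a coinitial subset of $M^{>0}$. The Hausdorff distance $D(X,Y)=\max\{\sup_{x\in X}\inf_{y\in Y}d(x,y),\ \sup_{y\in Y}\inf_{x\in X}d(x,y)\}$ takes values in the order completion of $M^{\ge0}$ by cuts (identifying, for each $g\in M$, the two cuts adjacent to $g$ with $g$). $(X_i)_{i<\kappa}$ is Cauchy if for every $\varepsilon\in M^{>0}$ there is $\gamma<\kappa$ with $D(X_i,X_j)<\varepsilon$ for all $\gamma<i,j<\kappa$; it converges to $X$ in the Hausdorff sense if for every $\varepsilon\in M^{>0}$ there is $\gamma<\kappa$ with $D(X_i,X)<\varepsilon$ for all $\gamma<i<\kappa$. *)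

(* Defs.v *)
From HB Require Import structures.
From mathcomp Require Import all_boot all_order all_algebra.
From mathcomp Require Import mathcomp_extra boolp classical_sets functions.
From mathcomp Require Import cardinality.
From mathcomp Require Import topology normedtype derive.

Set Implicit Arguments.
Unset Strict Implicit.
Unset Printing Implicit Defensive.
Import Order.TTheory GRing.Theory Num.Theory.
Import numFieldNormedType.Exports.
Local Open Scope classical_set_scope.
Local Open Scope card_scope.
Local Open Scope ring_scope.

(* A language expanding that of ordered rings: only the additional symbols are
   recorded, the ordered ring symbols are built into [term] and [formula].
   Accordingly structures are carried by an [rcfType], so that the axioms of
   real closed fields are implicitly part of every theory below. *)
Record language := Language {
  fsym : Type; farity : fsym -> nat;
  rsym : Type; rarity : rsym -> nat }.

Section Syntax.
Variable L : language.

Inductive term :=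
| TVar of nat
| TZero
| TOne
| TOpp of term
| TAdd of term & term
| TMul of term & term
| TFun (f : fsym L) of ('I_(farity f) -> term).

Inductive formula :=
| FEq of term & term
| FLt of term & term
| FRel (r : rsym L) of ('I_(rarity r) -> term)
| FNot of formula
| FAnd of formula & formula
| FEx of nat & formula.

Fixpoint term_vars (t : term) : set nat :=
  match t with
  | TVar i => [set i]
  | TZero | TOne => set0
  | TOpp t => term_vars t
  | TAdd t u | TMul t u => term_vars t `|` term_vars u
  | TFun _ ts => [set i | exists j, term_vars (ts j) i]
  end.

Fixpoint free_vars (phi : formula) : set nat :=
  match phi with
  | FEq t u | FLt t u => term_vars t `|` term_vars u
  | FRel _ ts => [set i | exists j, term_vars (ts j) i]
  | FNot phi => free_vars phi
  | FAnd phi psi => free_vars phi `|` free_vars psi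
  | FEx i phi => free_vars phi `\ i
  end.

Definition sentence : set formula := [set phi | free_vars phi = set0].

Record structure (M : rcfType) := Structure {
  fint : forall f : fsym L, ('I_(farity f) -> M) -> M;
  rint : forall r : rsym L, ('I_(rarity r) -> M) -> Prop }.

Section Semantics.
Variables (M : rcfType) (S : structure M).

Fixpoint eval (e : nat -> M) (t : term) : M :=
  match t with
  | TVar i => e i
  | TZero => 0
  | TOne => 1
  | TOpp t => - eval e t
  | TAdd t u => eval e t + eval e u
  | TMul t u => eval e t * eval e u
  | TFun f ts => fint S (f := f) (fun j => eval e (ts j))
  end.

Fixpoint sat (e : nat -> M) (phi : formula) : Prop :=
  match phi with
  | FEq t u => eval e t = eval e u
  | FLt t u => eval e t < eval e u
  | FRel r ts => rint S (r := r) (fun j => eval e (ts j))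
  | FNot phi => ~ sat e phi
  | FAnd phi psi => sat e phi /\ sat e psi
  | FEx i phi => exists v : M, sat (fun j => if j == i then v else e j) phi
  end.

Definition models (T : set formula) := forall phi, T phi -> forall e, sat e phi.

(* The entries of x are assigned to the variables 0, ..., k - 1, and the
   valuation e supplies the parameters through the other variables. *)
Definition assign k (x : 'rV[M]_k) (e : nat -> M) (i : nat) : M :=
  if (insub i : option 'I_k) is Some j then x 0 j else e i.

Definition definable k (A : set 'rV[M]_k) :=
  exists phi e, forall x, A x <-> sat (assign x e) phi.

Definition o_minimal := forall A : set 'rV[M]_1, definable A ->
  exists s : seq (interval M), A = [set x | has (fun i => x 0 0 \in i) s].

End Semantics.

Definition complete_theory (T : set formula) :=
  (exists (N : rcfType) (S : structure N), models S T) /\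
  forall phi, sentence phi ->
    (forall (N : rcfType) (S : structure N), models S T ->
       forall e, sat S e phi) \/
    (forall (N : rcfType) (S : structure N), models S T ->
       forall e, ~ sat S e phi).

Definition o_minimal_theory (T : set formula) :=
  forall (N : rcfType) (S : structure N), models S T -> o_minimal S.

Definition elementary (M N : rcfType) (S : structure M) (S' : structure N)
    (j : M -> N) :=
  forall phi e, sat S e phi <-> sat S' (j \o e) phi.

Definition dense_complete (T : set formula) (M : rcfType) (S : structure M) :=
  forall (N : rcfType) (S' : structure N) (j : M -> N),
    models S' T -> elementary S S' j ->
    (forall x y : N, x < y -> exists c : M, x < j c /\ j c < y) ->
    forall y : N, exists x : M, j x = y.

End Syntax.

Section Cells.
Variable M : rcfType.

(* Projection onto the first k coordinates; only meaningful for k <= N (the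
   missing coordinates are filled with zeros otherwise). *)
Definition Pi k N (x : 'rV[M]_N) : 'rV[M]_k :=
  \row_(i < k) (if (insub (val i) : option 'I_N) is Some j then x 0 j else 0).

Arguments Pi k {N} x.

Definition lastc k (x : 'rV[M]_k.+1) : M := x 0 ord_max.

Definition fiber m n (A : set 'rV[M]_(m + n)) (a : 'rV[M]_m) : set 'rV[M]_n :=
  [set x | A (row_mx a x)].

Definition graph k (U : set 'rV[M]_k) (f : 'rV[M]_k -> M) : set 'rV[M]_k.+1 :=
  [set z | U (Pi k z) /\ lastc z = f (Pi k z)].

(* [None] stands for -oo as a lower bound and for +oo as an upper bound. *)
Definition band k (U : set 'rV[M]_k) (lo hi : option ('rV[M]_k -> M)) :
    set 'rV[M]_k.+1 :=
  [set z | [/\ U (Pi k z),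
               if lo is Some f then f (Pi k z) < lastc z else True
             & if hi is Some g then lastc z < g (Pi k z) else True]].

Definition closed_band k (U : set 'rV[M]_k) (f g : 'rV[M]_k -> M) :
    set 'rV[M]_k.+1 :=
  [set z | U (Pi k z) /\ f (Pi k z) <= lastc z <= g (Pi k z)].

Inductive layer k :=
| Graph of ('rV[M]_k -> M)
| Band of option ('rV[M]_k -> M) & option ('rV[M]_k -> M).

Definition layer_set k (U : set 'rV[M]_k) (l : layer k) : set 'rV[M]_k.+1 :=
  match l with Graph f => graph U f | Band lo hi => band U lo hi end.

Definition finite_bounds k (l : layer k) : set ('rV[M]_k -> M) :=
  match l with
  | Graph f => [set f]
  | Band lo hi => [set h | lo = Some h \/ hi = Some h]
  end.

(* C^p functions on an open set V, by iterated partial derivatives. *)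
Fixpoint Cp_open (p : nat) k (V : set 'rV[M]_k) (F : 'rV[M]_k -> M) : Prop :=
  (forall x, V x -> {for x, continuous F}) /\
  if p is q.+1 then
    forall i : 'I_k,
      (forall x, V x -> derivable (F : _ -> M^o) x (delta_mx 0 i)) /\
      Cp_open q V (fun x => derive (F : _ -> M^o) x (delta_mx 0 i))
  else True.

Variables (L : language) (S : structure L M).

(* As usual for a domain U that need not be open, being C^p on U means having a
   definable C^p extension to a definable open set containing U. *)
Definition definable_Cp p k (U : set 'rV[M]_k) (f : 'rV[M]_k -> M) :=
  definable S (graph U f) /\
  exists (V : set 'rV[M]_k) (F : 'rV[M]_k -> M),
    [/\ open V, U `<=` V, definable S (graph V F), Cp_open p V F
      & forall x, U x -> F x = f x].

Definition Cp_layer p k (U : set 'rV[M]_k) (l : layer k) :=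
  (forall h, finite_bounds l h -> definable_Cp p U h) /\
  if l is Band (Some f) (Some g) then forall x, U x -> f x < g x else True.

(* The recursion starts from the one-point space M^0, so that the cells of M^1
   are the points and the open intervals with endpoints in M or infinite. *)
Inductive Cp_cell p : forall k, set 'rV[M]_k -> Prop :=
| Cp_cell0 : @Cp_cell p 0 setT
| Cp_cellS k (U : set 'rV[M]_k) (l : layer k) :
    Cp_cell p U -> Cp_layer p U l -> Cp_cell p (layer_set U l).

(* pres k presents the projection of A to M^(m + k + 1) over its projection to
   M^(m + k). *)
Definition presented_over p m n (A : set 'rV[M]_(m + n))
    (pres : forall k, layer (m + k)) :=
  forall k, (k < n)%N ->
    Cp_layer p (Pi (m + k) @` A) (pres k) /\
    Pi (m + k).+1 @` A = layer_set (Pi (m + k) @` A) (pres k).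

Definition fibers_lipschitz (lam : M) m n (A : set 'rV[M]_(m + n))
    (pres : forall k, layer (m + k)) :=
  forall k, (k < n)%N -> forall a, (Pi m @` A) a ->
  forall h, finite_bounds (pres k) h ->
    lam.-lipschitz_(fiber (Pi (m + k) @` A) a)
      (fun y : 'rV[M]_k => h (row_mx a y) : M^o).

(* In dimension 1, [interval M] covers points, bounded intervals (with or
   without their endpoints), rays and M itself. *)
Inductive lip_limit_cell (lam : M) : forall n, set 'rV[M]_n -> Prop :=
| Llc1 (i : interval M) :
    [set` i] !=set0 -> @lip_limit_cell lam 1 [set x | x 0 0 \in i]
| LlcGraph n (U : set 'rV[M]_n) (f : 'rV[M]_n -> M) :
    lip_limit_cell lam U -> lam.-lipschitz_U (f : _ -> M^o) ->
    lip_limit_cell lam (graph U f)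
| LlcBand n (U : set 'rV[M]_n) (f g : 'rV[M]_n -> M) :
    lip_limit_cell lam U ->
    lam.-lipschitz_U (f : _ -> M^o) -> lam.-lipschitz_U (g : _ -> M^o) ->
    (forall x, U x -> f x <= g x) ->
    lip_limit_cell lam (closed_band U f g).

End Cells.

Arguments Pi {M} k {N} x.

Section Completion.
Variable M : rcfType.
Implicit Types X : set M.

Definition nneg_ubound X : set M := [set u | 0 <= u] `&` ubound X.
Definition nneg_lbound X : set M := [set l | 0 <= l] `&` lbound X.
Definition cut_closure X : set M := nneg_lbound (nneg_ubound X).

(* Dedekind-MacNeille cuts: a cut is given by its lower part, which contains g
   whenever g is its supremum in M; thus the two cuts adjacent to g are
   identified. The top cut, [set x | 0 <= x], is the value +oo. *)
Record cut := Cut {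
  cut_set :> set M;
  cut_setP : cut_closure cut_set = cut_set }.

Lemma cut_closureK X : cut_closure (cut_closure X) = cut_closure X.
Proof.
apply/seteqP; split=> [l [l0 lX]|l [l0 lX]]; split=> // u.
  by move=> [u0 uX]; apply: lX; split=> // v [v0 vX]; apply: vX; split.
by move=> [u0 uX]; apply: uX; split.
Qed.

Definition mk_cut X : cut := Cut (cut_closureK X).

Definition cut_of (g : M) : cut := mk_cut [set g].
Definition cut_sup (F : set cut) : cut :=
  mk_cut (\bigcup_(C in F) cut_set C).
Definition cut_inf (F : set cut) : cut :=
  mk_cut ([set x | 0 <= x] `&` \bigcap_(C in F) cut_set C).
Definition cut_max (C D : cut) : cut := mk_cut (cut_set C `|` cut_set D).
Definition cut_lt (C D : cut) : Prop := cut_set C `<` cut_set D.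

(* The norm on row vectors is the sup norm. *)
Definition dist n (x y : 'rV[M]_n) : M := `|x - y|.

Definition hausdorff n (X Y : set 'rV[M]_n) : cut :=
  cut_max
    (cut_sup [set cut_inf [set cut_of (dist x y) | y in Y] | x in X])
    (cut_sup [set cut_inf [set cut_of (dist x y) | x in X] | y in Y]).

End Completion.

Section Sequences.
Variable M : rcfType.

Definition coinitial_pos (X : set M) :=
  X `<=` [set x | 0 < x] /\
  forall e : M, 0 < e -> exists2 x, X x & x <= e.

(* I is (order isomorphic to) the least cardinality of a coinitial subset of
   the positive elements of M, seen as an initial ordinal. *)
Definition is_coinitiality d (I : orderType d) :=
  [/\ well_founded (fun i j : I => (i < j)%O),
      forall i : I, ~ ([set: I] #<= [set j : I | (j < i)%O]),
      exists2 X : set M, coinitial_pos X & X #= [set: I]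
    & forall X : set M, coinitial_pos X -> [set: I] #<= X].

Variables (d : Order.disp_t) (I : orderType d) (n : nat).
Implicit Type X : I -> set 'rV[M]_n.

Definition hausdorff_cauchy X :=
  forall e : M, 0 < e -> exists c : I, forall i j : I,
    (c < i)%O -> (c < j)%O -> cut_lt (hausdorff (X i) (X j)) (cut_of e).

Definition hausdorff_cvg X (B : set 'rV[M]_n) :=
  forall e : M, 0 < e -> exists c : I, forall i : I,
    (c < i)%O -> cut_lt (hausdorff (X i) B) (cut_of e).

End Sequences.

(* Main.v *)
(* The heart of the matter is that a dense complete model M is Cauchy complete.
   If a cut C of M with arbitrarily short intervals around it is not filled in
   M, the germs at C of the definable functions M -> M form, by o-minimality and
   definable choice, an elementary extension of M (a definable ultrapower). M is
   dense in it, because every definable function has arbitrarily small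
   oscillation near C and every positive one is bounded below near C; but no
   element of M is equal to the germ of the identity, against dense
   completeness.
   Given Cauchy completeness, the limit cell is built one coordinate at a time:
   if the projected fibers converge to U, the boundary functions of the next
   layer are uniformly Lipschitz and close to each other in the uniform sense
   (this is read off the Hausdorff distance of the fibers), so that they
   converge to a Lipschitz function on U. *)
Require Import Defs.
From HB Require Import structures.
From mathcomp Require Import all_boot all_order all_algebra.
From mathcomp Require Import classical_sets topology normedtype.
From mathcomp Require Import boolp lra ring zify.
Set Implicit Arguments.
Unset Strict Implicit.
Unset Printing Implicit Defensive.
Import Order.TTheory GRing.Theory Num.Theory.
Import numFieldNormedType.Exports.
Local Open Scope classical_set_scope.
Local Open Scope ring_scope.

(** * Definable predicates and functions *)

(** Everything drawn from o-minimality comes down to one dichotomy: a definable set contains an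
    interval across a given proper cut or avoids one. It yields suprema of definable sets, hence
    definable choice. The oscillation bound follows from it. A function whose values jump by [eps]
    on one side of each point of an interval would take [eps]-separated values on a shorter
    interval, which no definable function does. So near [C] each point has a radius within which [f]
    varies by at most [eps]. Chosen definably, this radius is bounded below near [C], and the Cauchy
    property of the cut then gives an interval across [C] shorter than that bound. In the limit
    argument the boundary functions of different fibers have different domains, and a band contains
    neither of its boundaries. So values are compared at nearby points and located by points of the
    band just inside its boundary; the Lipschitz constant turns a displacement in the base into one
    of the value. The strict inequality between the two boundaries becomes a weak one in the limit,
    whence the closed bands. *)

Section Renaming.
Variable L : language.

Fixpoint tren (r : nat -> nat) (t : term L) : term L :=
  match t with
  | TVar i => TVar L (r i)
  | TZero => TZero L
  | TOne => TOne L
  | TOpp t => TOpp (tren r t)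
  | TAdd t u => TAdd (tren r t) (tren r u)
  | TMul t u => TMul (tren r t) (tren r u)
  | TFun f ts => TFun (fun j => tren r (ts j))
  end.

Fixpoint fren (r : nat -> nat) (phi : formula L) : formula L :=
  match phi with
  | FEq t u => FEq (tren r t) (tren r u)
  | FLt t u => FLt (tren r t) (tren r u)
  | FRel R ts => FRel (fun j => tren r (ts j))
  | FNot phi => FNot (fren r phi)
  | FAnd phi psi => FAnd (fren r phi) (fren r psi)
  | FEx i phi => FEx (r i) (fren r phi)
  end.

Variables (M : rcfType) (S : structure L M).

Lemma eval_tren r t e : Defs.eval S e (tren r t) = Defs.eval S (e \o r) t.
Proof.
elim: t => //= [t -> //|t -> u -> //|t -> u -> //|f ts IH].
by congr (fint _ _); apply: funext => j; exact: IH.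
Qed.

(** Bound variables are renamed along with the free ones. Injectivity rules out capture: updating
    the valuation at [r i] changes [e \o r] at [i] only. *)
Lemma sat_fren r phi e : injective r ->
  sat S e (fren r phi) = sat S (e \o r) phi.
Proof.
move=> r_inj; elim: phi e => //= [t u|t u|R ts|phi IH|phi IH1 psi IH2|i phi IH] e.
- by rewrite !eval_tren.
- by rewrite !eval_tren.
- by congr (rint _ _); apply: funext => j; rewrite eval_tren.
- by rewrite IH.
- by rewrite IH1 IH2.
- congr (ex _); apply: funext => v; rewrite IH; congr (sat _ _ _).
  by apply: funext => j /=; rewrite (inj_eq r_inj).
Qed.

End Renaming.

Section Definability.
Variables (L : language) (M : rcfType) (S : structure L M).
Implicit Types (x e : nat -> M) (P Q : (nat -> M) -> Prop).

Definition scons (v : M) x (i : nat) : M := if i is j.+1 then x j else v.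

Definition stail x (i : nat) : M := x i.+1.

Lemma scons_stail x : scons (x 0%N) (stail x) = x.
Proof. by apply: funext => -[]. Qed.

(* Even variables carry the arguments, odd variables the parameters. *)
Definition mix x e (i : nat) : M := if odd i then e i./2 else x i./2.

(** Predicates of a whole valuation treat all arities at once. The parity encoding of [mix] leaves
    room for arbitrarily many parameters next to arbitrarily many arguments. *)
Definition Dpred P :=
  exists (phi : formula L) e, forall x, P x <-> sat S (mix x e) phi.

Lemma Dpred_ext P Q : (forall x, P x <-> Q x) -> Dpred P -> Dpred Q.
Proof.
by move=> PQ [phi [e H]]; exists phi, e => x; rewrite -PQ.
Qed.

Lemma Dnot P : Dpred P -> Dpred (fun x => ~ P x).
Proof. by move=> [phi [e H]]; exists (FNot phi), e => x /=; rewrite H. Qed.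

Lemma Dand P Q : Dpred P -> Dpred Q -> Dpred (fun x => P x /\ Q x).
Proof.
move=> [phi [e HP]] [psi [e' HQ]].
(* Each formula has its own parameters. Slot k of the first goes to slot 2k of the interleaved
   [mix e e'], slot k of the second to slot 2k + 1; arguments stay in place. *)
pose r b i := if odd i then (i./2.*2 + b).*2.+1 else i.
have r_inj (b : bool) : injective (r b).
  by move=> i j; rewrite /r; case: b => /=; rewrite ?addn1 ?addn0; do 2 case: ifP; lia.
have mixr (b : bool) x : mix x (mix e e') \o r b = mix x (if b then e' else e).
  apply: funext => i; rewrite /= /mix /r.
  case: (boolP (odd i)) => oi; last by rewrite (negbTE oi).
  rewrite /= odd_double /= uphalf_double oddD odd_double /=.
  by case: b => /=; rewrite ?addn1 ?addn0 /= ?uphalf_double ?doubleK.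
exists (FAnd (fren (r false) phi) (fren (r true) psi)), (mix e e') => x /=.
by rewrite (sat_fren _ _ _ (r_inj false)) (sat_fren _ _ _ (r_inj true)) !mixr HP HQ.
Qed.

Lemma Dor P Q : Dpred P -> Dpred Q -> Dpred (fun x => P x \/ Q x).
Proof.
move=> dP dQ; apply: (@Dpred_ext (fun x => ~ (~ P x /\ ~ Q x))).
  by move=> x; split; [move=> /not_andP[/contrapT|/contrapT]; tauto|tauto].
exact/Dnot/Dand/Dnot/dQ/Dnot.
Qed.

Lemma Dimp P Q : Dpred P -> Dpred Q -> Dpred (fun x => P x -> Q x).
Proof.
move=> dP dQ; apply: (@Dpred_ext (fun x => ~ P x \/ Q x)).
  by move=> x; split; [tauto|move=> h; case: (EM (P x)); tauto].
exact/Dor/dQ/Dnot.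
Qed.

Lemma Dex (Q : M -> (nat -> M) -> Prop) :
  Dpred (fun y => Q (y 0%N) (fun i => y i.+1)) ->
  Dpred (fun x => exists v, Q v x).
Proof.
move=> [phi [e H]].
(* Argument 0 moves to variable 1, the first parameter slot, where it is quantified. The other
   arguments move down by one place and the parameters up by one; the freed slot holds the junk
   value 0 of [scons 0 e]. *)
pose r i := if i is 0 then 1%N else if odd i then i.+2 else i.-2.
have r_inj : injective r by move=> [|i] [|j]; rewrite /r //=; do ?case: ifP; lia.
have upd v x : (fun j => if j == 1%N then v else mix x (scons 0 e) j) \o r
    = mix (scons v x) e.
  apply: funext => -[//|i]; rewrite -(odd_double_half i) /mix /r /=.
  case: (odd i); rewrite ?add1n ?add0n /= ?negbK !odd_double //=.
    by case: eqP => // /(congr1 odd); rewrite odd_double.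
  by rewrite negbK odd_double.
exists (FEx 1 (fren r phi)), (scons 0 e) => x /=.
by split=> -[v Hv]; exists v; move: Hv; rewrite sat_fren // upd -H.
Qed.



Lemma Dall (Q : M -> (nat -> M) -> Prop) :
  Dpred (fun y => Q (y 0%N) (fun i => y i.+1)) ->
  Dpred (fun x => forall v, Q v x).
Proof.
move=> dQ; apply: (@Dpred_ext (fun x => ~ exists v, ~ Q v x)).
  by move=> x; split=> [/forallNP h v|h [v nq]]; [exact: contrapT (h v)|exact/nq/h].
exact/Dnot/(@Dex (fun v x => ~ Q v x))/Dnot.
Qed.

Lemma Dreindex_inj r P : injective r -> Dpred P -> Dpred (fun x => P (x \o r)).
Proof.
move=> r_inj [phi [e H]].
pose r' i := if odd i then i else (r i./2).*2.
have r'_inj : injective r'.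
  move=> i j; rewrite /r'; do 2 (case: ifP => ?); try lia.
  by move=> /double_inj/r_inj; lia.
exists (fren r' phi), e => x; rewrite sat_fren // H.
suff -> : mix (x \o r) e = mix x e \o r' by [].
apply: funext => i; rewrite /= /mix /r'.
case: (boolP (odd i)) => oi; first by rewrite oi.
by rewrite odd_double doubleK.
Qed.

Definition Dterm (tau : (nat -> M) -> M) :=
  Dpred (fun y => y 0%N = tau (fun i => y i.+1)).

Lemma Dterm_ext (tau tau' : (nat -> M) -> M) :
  (forall x, tau x = tau' x) -> Dterm tau -> Dterm tau'.
Proof. by move=> h; apply: Dpred_ext => x; rewrite h. Qed.

Lemma Dterm_reindex_inj r (tau : (nat -> M) -> M) : injective r -> Dterm tau ->
  Dterm (fun x => tau (x \o r)).
Proof.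
move=> r_inj /(@Dreindex_inj (fun i => if i is j.+1 then (r j).+1 else 0%N)).
by apply=> -[|i] [|j] // [/r_inj ->].
Qed.

Lemma Dvar i : Dterm (fun x => x i).
Proof.
exists (FEq (TVar L 0) (TVar L i.+1.*2)), (fun _ => 0) => x /=.
by rewrite /mix odd_double doubleK.
Qed.

Lemma Dcst c : Dterm (fun _ => c).
Proof. by exists (FEq (TVar L 0) (TVar L 1)), (fun _ => c). Qed.

Lemma Dsubst1 Q tau : Dpred Q -> Dterm tau ->
  Dpred (fun x => Q (scons (tau x) x)).
Proof.
move=> dQ dtau.
apply: (@Dpred_ext (fun x => exists v, v = tau x /\ Q (scons v x))).
  by move=> x; split=> [[v [->]]|] //; exists (tau x).
apply: (@Dex (fun v x => v = tau x /\ Q (scons v x))); apply: Dand => //.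
by apply: Dpred_ext dQ => x; rewrite -{1}(scons_stail x).
Qed.

Fixpoint prepend k (tau : nat -> (nat -> M) -> M) x : nat -> M :=
  if k is k'.+1 then scons (tau 0%N x) (prepend k' (fun i => tau i.+1) x)
  else x.

Lemma prepend_lt k tau x i : (i < k)%N -> prepend k tau x i = tau i x.
Proof. by elim: k i tau => // k IH [|i] tau //= ik; rewrite IH. Qed.

Lemma prepend_ge k tau x i : prepend k tau x (k + i) = x i.
Proof. by elim: k tau => // k IH tau /=; rewrite IH. Qed.

(** Terms are substituted one at a time. When [tau 0] is put in front of k entries already
    prepended, it is read on the valuation shifted by k, so that every term sees the original
    [x]. *)
Lemma Dprepend k tau Q : Dpred Q -> (forall i, Dterm (tau i)) ->
  Dpred (fun x => Q (prepend k tau x)).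
Proof.
elim: k tau Q => [|k IH] tau Q dQ dtau //=.
have dt : Dterm (fun y => tau 0%N (fun i => y (k + i)%N)).
  by apply: (@Dterm_reindex_inj (addn k)) => // i j /addnI.
have := IH (fun i => tau i.+1) _ (Dsubst1 dQ dt) (fun i => dtau i.+1).
apply: Dpred_ext => x; set y := prepend _ _ _.
by have -> : (fun i => y (k + i)%N) = x
  by apply: funext => i; rewrite /y prepend_ge.
Qed.

Definition args2 (t u : (nat -> M) -> M) (i : nat) : (nat -> M) -> M :=
  match i with 0 => t | 1 => u | _ => fun _ => 0 end.

Lemma Dargs2 t u : Dterm t -> Dterm u -> forall i, Dterm (args2 t u i).
Proof. by move=> dt du [|[|i]] //; exact: Dcst. Qed.

Lemma Deq t u : Dterm t -> Dterm u -> Dpred (fun x => t x = u x).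
Proof.
move=> dt du; apply: (Dprepend 2 (Dvar 0) (Dargs2 dt du)).
Qed.

Lemma Dlt t u : Dterm t -> Dterm u -> Dpred (fun x => t x < u x).
Proof.
move=> dt du; have d : Dpred (fun y => y 0%N < y 1%N).
  by exists (FLt (TVar L 0) (TVar L 2)), (fun _ => 0).
exact: (Dprepend 2 d (Dargs2 dt du)).
Qed.

Lemma Dweaken t : Dterm t -> Dterm (fun x => t (fun i => x i.+1)).
Proof. by apply: (@Dterm_reindex_inj Datatypes.S) => i j []. Qed.

Lemma Dbin (F : M -> M -> M) t u :
  Dpred (fun y => y 2 = F (y 0%N) (y 1%N)) -> Dterm t -> Dterm u ->
  Dterm (fun x => F (t x) (u x)).
Proof.
move=> dF dt du.
exact: (Dprepend 2 dF (Dargs2 (Dweaken dt) (Dweaken du))).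
Qed.

Lemma Dadd t u : Dterm t -> Dterm u -> Dterm (fun x => t x + u x).
Proof.
apply: Dbin.
by exists (FEq (TVar L 4) (TAdd (TVar L 0) (TVar L 2))), (fun _ => 0).
Qed.

Lemma Dmul t u : Dterm t -> Dterm u -> Dterm (fun x => t x * u x).
Proof.
apply: Dbin.
by exists (FEq (TVar L 4) (TMul (TVar L 0) (TVar L 2))), (fun _ => 0).
Qed.

Lemma Dopp t : Dterm t -> Dterm (fun x => - t x).
Proof.
move=> /Dmul-/(_ _ (Dcst (-1))); apply: Dterm_ext => x.
by rewrite mulrN1.
Qed.

Lemma Dfint (f : Defs.fsym L) (tau : 'I_(farity f) -> (nat -> M) -> M) :
  (forall j, Dterm (tau j)) -> Dterm (fun x => fint S (fun j => tau j x)).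
Proof.
move=> dtau; set k := farity f.
pose tau' i := if insub i is Some j then tau j else (fun _ => 0).
have dtau' i : Dterm (fun x => tau' i (fun i => x i.+1)).
  by apply: Dweaken; rewrite /tau'; case: insubP => // _; exact: Dcst.
have d : Dpred (fun y => y k = fint S (fun j : 'I_k => y j)).
  exists (FEq (TVar L k.*2) (TFun (fun j : 'I_k => TVar L j.*2))), (fun _ => 0).
  move=> x /=; rewrite /mix odd_double doubleK.
  by have -> : (fun j : 'I_k => if odd j.*2 then 0 else x (j.*2)./2) =
      (fun j : 'I_k => x j)
    by apply: funext => j; rewrite odd_double doubleK.
apply: Dpred_ext (Dprepend k d dtau') => x.
rewrite -[X in prepend _ _ _ X]addn0 prepend_ge.
suff -> : (fun j : 'I_k => prepend k (fun i x => tau' i (fun i => x i.+1)) x j)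
  = (fun j => tau j (fun i => x i.+1)) by [].
by apply: funext => j; rewrite prepend_lt // /tau' valK.
Qed.

Lemma Drint (R : Defs.rsym L) (tau : 'I_(rarity R) -> (nat -> M) -> M) :
  (forall j, Dterm (tau j)) -> Dpred (fun x => rint S (fun j => tau j x)).
Proof.
move=> dtau; set k := rarity R.
pose tau' i := if insub i is Some j then tau j else (fun _ => 0).
have dtau' i : Dterm (tau' i).
  by rewrite /tau'; case: insubP => // _; exact: Dcst.
have d : Dpred (fun y => rint S (fun j : 'I_k => y j)).
  exists (FRel (fun j : 'I_k => TVar L j.*2)), (fun _ => 0) => x /=.
  rewrite /mix.
  by have -> : (fun j : 'I_k => if odd j.*2 then 0 else x (j.*2)./2) =
      (fun j : 'I_k => x j)
    by apply: funext => j; rewrite odd_double doubleK.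
apply: Dpred_ext (Dprepend k d dtau') => x.
suff -> : (fun j : 'I_k => prepend k tau' x j) = (fun j => tau j x) by [].
by apply: funext => j; rewrite prepend_lt // /tau' valK.
Qed.

Lemma Deval t (sigma : nat -> (nat -> M) -> M) : (forall i, Dterm (sigma i)) ->
  Dterm (fun x => Defs.eval S (fun i => sigma i x) t).
Proof.
move=> ds; elim: t => /=.
- by [].
- exact: Dcst.
- exact: Dcst.
- by move=> t; exact: Dopp.
- by move=> t dt u; exact: Dadd.
- by move=> t dt u; exact: Dmul.
- by move=> f ts dts; exact: Dfint.
Qed.

Lemma Dsat phi (sigma : nat -> (nat -> M) -> M) : (forall i, Dterm (sigma i)) ->
  Dpred (fun x => sat S (fun i => sigma i x) phi).
Proof.
elim: phi sigma => /= [t u|t u|R ts|phi IH|phi IH1 psi IH2|i phi IH] sigma ds.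
- by apply: Deq; exact: Deval.
- by apply: Dlt; exact: Deval.
- by apply: Drint => j; exact: Deval.
- exact/Dnot/IH.
- by apply: Dand; [exact: IH1|exact: IH2].
- apply: (@Dex (fun v x => sat S (fun j => if j == i then v else sigma j x) phi)).
  apply: (IH (fun j y => if j == i then y 0%N else sigma j (fun i => y i.+1))).
  move=> j; case: eqP => _; [exact: Dvar|exact: Dweaken].
Qed.

(** Substitution in all variables at once, with repetitions allowed. It goes through the induction
    on formulas in [Dsat], the parameters being constant terms. *)
Lemma Dcomp P (tau : nat -> (nat -> M) -> M) : Dpred P ->
  (forall i, Dterm (tau i)) -> Dpred (fun x => P (fun i => tau i x)).
Proof.
move=> [phi [e H]] dtau.
pose sigma i x := if odd i then e i./2 else tau i./2 x.
have ds i : Dterm (sigma i).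
  by rewrite /sigma; case: (odd i); [exact: Dcst|exact: dtau].
by apply: Dpred_ext (Dsat phi ds) => x; rewrite H.
Qed.

Definition Dset (X : set M) := Dpred (fun x => X (x 0%N)).
Definition Dfun (f : M -> M) := Dterm (fun x => f (x 0%N)).
Definition Drel (R : M -> M -> Prop) := Dpred (fun x => R (x 0%N) (x 1%N)).

Lemma Dsetin X t : Dset X -> Dterm t -> Dpred (fun x => X (t x)).
Proof. by move=> dX dt; exact: (Dcomp dX (fun i => dt)). Qed.

Lemma Drelin R t u : Drel R -> Dterm t -> Dterm u -> Dpred (fun x => R (t x) (u x)).
Proof. by move=> dR dt du; exact: (Dcomp dR (Dargs2 dt du)). Qed.

Lemma Dapp f t : Dfun f -> Dterm t -> Dterm (fun x => f (t x)).
Proof.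
move=> df dt; have dg : Drel (fun v w => v = f w) by [].
by apply: (Drelin dg); [exact: Dvar|exact: Dweaken].
Qed.

Lemma Dle t u : Dterm t -> Dterm u -> Dpred (fun x => t x <= u x).
Proof.
move=> dt du; apply: (Dpred_ext _ (Dnot (Dlt du dt))) => x.
by rewrite leNgt; split => /negP.
Qed.

(* f has the junk value 0 where R has no value. *)
Lemma Dfun_unique (R : M -> M -> Prop) (f : M -> M) : Drel R ->
  (forall t z z', R t z -> R t z' -> z = z') ->
  (forall t, (exists z, R t z) -> R t (f t)) ->
  (forall t, ~ (exists z, R t z) -> f t = 0) -> Dfun f.
Proof.
move=> dR uR fR f0.
apply: (@Dpred_ext (fun x => R (x 1%N) (x 0%N) \/
   ~ (exists z, R (x 1%N) z) /\ x 0%N = 0)).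
  move=> x; split=> [[h|[h ->]]|->].
  - by apply: (uR (x 1%N)) => //; apply: fR; exists (x 0%N).
  - by rewrite f0.
  - by have [h|h] := EM (exists z, R (x 1%N) z); [left; exact: fR|right; rewrite f0].
apply: Dor; first by apply: Drelin; [|exact: Dvar..].
apply: Dand; last by apply: Deq; [exact: Dvar|exact: Dcst].
apply: Dnot; apply: (@Dex (fun v x => R (x 1%N) v)).
by apply: Drelin; [|exact: Dvar..].
Qed.

End Definability.

Ltac definable :=
  lazymatch goal with
  | |- forall _, _ => intro; definable
  | |- Dset _ _ => assumption || (rewrite /Dset; definable)
  | |- Drel _ _ => assumption || (rewrite /Drel; definable)
  | |- Dfun _ _ => assumption || (rewrite /Dfun; definable)
  | |- Dpred _ (fun x => ~ _) => apply: Dnot; definable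
  | |- Dpred _ (fun x => _ /\ _) => apply: Dand; definable
  | |- Dpred _ (fun x => _ \/ _) => apply: Dor; definable
  | |- Dpred _ (fun x => ex _) => apply: Dex; cbv beta; definable
  | |- Dpred _ (fun x => exists v : _, _) => apply: Dex; cbv beta; definable
  | |- Dpred _ (fun x => forall v, _) =>
      first [apply: Dall; cbv beta | apply: Dimp]; definable
  | |- Dpred _ (fun x => is_true (_ <= _)) => apply: Dle; definable
  | |- Dpred _ (fun x => is_true (_ < _)) => apply: Dlt; definable
  | |- Dpred _ (fun x => _ = _) => apply: Deq; definable
  | |- Dpred _ (fun x => ?R _ _) => apply: (@Drelin _ _ _ R); 
      [try assumption | definable..]
  | |- Dpred _ (fun x => ?R _) => apply: (@Dsetin _ _ _ R); [try assumption | definable]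
  | |- Dterm _ (fun x => x _) => exact: Dvar
  | |- Dterm _ (fun x => _ + _) => apply: Dadd; definable
  | |- Dterm _ (fun x => _ * _) => apply: Dmul; definable
  | |- Dterm _ (fun x => - _) => apply: Dopp; definable
  | |- Dterm _ (fun x => ?f _) =>
      first [exact: Dcst | apply: (@Dapp _ _ _ f); [try assumption | definable]]
  | |- Dterm _ _ => exact: Dcst
  | _ => idtac
  end.

(** * Germs of definable sets at a cut *)

Section AtCut.
Variable M : rcfType.
Implicit Types (C X Y : set M).

Definition proper_cut C :=
  [/\ exists d, C d, exists e, ~ C e & forall x y, C y -> x <= y -> C x].

(** The filter generated by the intervals that straddle [C]. For the cuts [proper_left t] and
    [proper_right t] it becomes the one-sided germs at the point [t]. *)
Definition at_cut C X :=
  exists d e, [/\ C d, ~ C e & forall s, d < s -> s < e -> X s].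

Lemma at_cutT C X : proper_cut C -> (forall s, X s) -> at_cut C X.
Proof. by move=> [[d Cd] [e Ce] _] h; exists d, e. Qed.

Lemma at_cut_mono C X Y : (forall s, X s -> Y s) -> at_cut C X -> at_cut C Y.
Proof.
by move=> XY [d [e [Cd Ce h]]]; exists d, e; split=> // s ds se; exact/XY/h.
Qed.

Lemma cut_lt_out C d e : proper_cut C -> C d -> ~ C e -> d < e.
Proof. by move=> [_ _ dC] Cd Ce; rewrite ltNge; apply/negP => /(dC _ _ Cd). Qed.

Lemma at_cutI C X Y : proper_cut C -> at_cut C X -> at_cut C Y ->
  at_cut C (fun s => X s /\ Y s).
Proof.
move=> pC [d [e [Cd Ce hX]]] [d' [e' [Cd' Ce' hY]]].
exists (Num.max d d'), (Num.min e e'); split.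
- by case: (leP d d').
- by case: (leP e e').
- by move=> s; rewrite gt_max lt_min => /andP[? ?] /andP[? ?]; split; auto.
Qed.

Lemma at_cut_ex C X : proper_cut C -> at_cut C X -> exists s, X s.
Proof.
move=> pC [d [e [Cd Ce h]]]; exists ((d + e) / 2).
by have := cut_lt_out pC Cd Ce => de; apply: h; lra.
Qed.

Lemma at_cutN C X : proper_cut C -> at_cut C X -> at_cut C (fun s => ~ X s) ->
  False.
Proof. by move=> pC h /(at_cutI pC h)/(at_cut_ex pC)[s []]. Qed.

Definition is_lub X w :=
  (forall x, X x -> x <= w) /\ (forall u, (forall x, X x -> x <= u) -> w <= u).

Lemma is_lub_unique X w w' : is_lub X w -> is_lub X w' -> w = w'.
Proof. by move=> [h1 h2] [h1' h2']; apply/le_anti; rewrite h2 ?h2'. Qed.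

Lemma is_lub_gt X w u : is_lub X w -> u < w -> exists2 x, X x & u < x.
Proof.
move=> [_ h] uw; apply: contrapT => nX.
suff /h : forall x, X x -> x <= u by rewrite leNgt uw.
by move=> x Xx; rewrite leNgt; apply/negP => ux; apply: nX; exists x.
Qed.

Lemma proper_left t : proper_cut [set x : M | x < t].
Proof.
split=> /=; [exists (t - 1); lra|exists t; rewrite ltxx //|move=> x y ?].
by move=> /le_lt_trans; apply.
Qed.

Lemma proper_right t : proper_cut [set x : M | x <= t].
Proof.
split=> /=; [by exists t|exists (t + 1); apply/negP; lra|move=> x y ?].
by move=> /le_trans; apply.
Qed.

Lemma proper_below X x : X x -> (exists u, forall x, X x -> x <= u) ->
  proper_cut [set y | exists2 x, X x & y <= x].
Proof.
move=> Xx [u Xu]; split=> /=.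
- by exists x; exists x.
- exists (u + 1) => -[y /Xu yu]; lra.
- by move=> y z [v Xv zv] yz; exists v => //; exact: le_trans yz zv.
Qed.

End AtCut.

(** * Suprema and definable choice from o-minimality *)

Section OMinimal.
Variables (L : language) (M : rcfType) (S : structure L M).
Hypothesis omin : o_minimal S.
Implicit Types (C X Y : set M).
Local Notation Dset := (Dset S).
Local Notation Drel := (Drel S).
Local Notation Dfun := (Dfun S).

Lemma Dset_intervals X : Dset X ->
  exists s : seq (interval M), forall x, X x <-> has (fun i => x \in i) s.
Proof.
move=> [phi [e H]].
have [|s sE] := omin (A := [set z | X (z 0 0)]).
  exists phi, (mix (fun _ => 0) e) => z /=.
  have -> : z 0 0 = assign z (fun _ => 0) 0%N.
    by rewrite /assign insubT //=; congr (z 0 _); apply: val_inj.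
  rewrite (H (assign z (fun _ => 0))).
  suff -> : mix (assign z (fun _ => 0)) e = assign z (mix (fun _ => 0) e) by [].
  apply: funext => -[|[|i]]; rewrite /mix /assign /=.
  - by rewrite insubT.
  - by rewrite insubF.
  - by rewrite !insubF //= negbK; case: ifP.
exists s => x.
have := congr1 (fun B => B (const_mx x : 'rV_1)) sE.
by rewrite /= mxE => ->.
Qed.

(** The filter at a cut is an ultrafilter on definable sets: the sets it decides contain the rays
    and are closed under complement and intersection, so they include all finite unions of
    intervals. *)
Lemma at_cut_dec C X : proper_cut C -> Dset X ->
  at_cut C X \/ at_cut C (fun s => ~ X s).
Proof.
move=> pC /Dset_intervals[s sE].
pose dec Y := at_cut C Y \/ at_cut C (fun s => ~ Y s).
have decI Y Z : dec Y -> dec Z -> dec (fun s => Y s /\ Z s).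
  move=> [hY|hY] [hZ|hZ]; [left; exact: at_cutI|right..].
  - by apply: at_cut_mono hZ; tauto.
  - by apply: at_cut_mono hY; tauto.
  - by apply: at_cut_mono hY; tauto.
have decN Y : dec Y -> dec (fun s => ~ Y s).
  by move=> [hY|hY]; [right; apply: at_cut_mono hY|left]; tauto.
have decE Y Z : (forall s, Y s <-> Z s) -> dec Y -> dec Z.
  by move=> YZ [hY|hY]; [left|right]; apply: at_cut_mono hY => x; rewrite YZ.
have dec_lt x : dec (fun s => s < x).
  have [[d Cd] [e Ce] dC] := pC.
  have [Cx|Cx] := EM (C x); [right|left].
    by exists x, e; split=> // y xs _; apply/negP; rewrite -leNgt ltW.
  by exists d, x.
have dec_le x : dec (fun s => s <= x).
  have [[d Cd] [e Ce] dC] := pC.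
  have [Cx|Cx] := EM (C x); [right|left].
    by exists x, e; split=> // y xs _; apply/negP; rewrite -ltNge.
  by exists d, x; split=> // y _ /ltW.
have decT (b : bool) : dec (fun _ => b).
  by case: b; [left|right]; apply: at_cutT.
have dec_itv (i : interval M) : dec (fun s => s \in i).
  case: i => l r.
  apply: (decE (fun s => (l <= BLeft s)%O /\ (BRight s <= r)%O)).
    by move=> x; rewrite itv_boundlr; split=> [[-> ->]|/andP].
  apply: decI.
    case: l => [[] y|[]].
    - apply: (decE (fun s => ~ s < y)) (decN _ (dec_lt y)) => x.
      by rewrite bnd_simp; split=> [/negP|?]; [|apply/negP]; rewrite -leNgt.
    - apply: (decE (fun s => ~ s <= y)) (decN _ (dec_le y)) => x.
      by rewrite bnd_simp; split=> [/negP|?]; [|apply/negP]; rewrite -ltNge.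
    - exact: decE (decT true).
    - exact: decE (decT false).
  case: r => [[] y|[]].
  - by apply: decE (dec_lt y) => x; rewrite bnd_simp.
  - by apply: decE (dec_le y) => x; rewrite bnd_simp.
  - exact: decE (decT false).
  - exact: decE (decT true).
apply: (decE _ _ (fun s => iff_sym (sE s))).
elim: s {sE} => [|i s IH] /=; first exact: decT.
apply: (decE (fun x => ~ (~ x \in i /\ ~ has (fun i => x \in i) s))).
  move=> x; rewrite -(rwP orP).
  have := EM (x \in i); have := EM (has (fun i => x \in i) s); tauto.
exact/decN/decI/decN/IH/decN.
Qed.

Lemma at_cutNE C X : proper_cut C -> Dset X ->
  ~ at_cut C X -> at_cut C (fun s => ~ X s).
Proof. by move=> pC /(at_cut_dec pC)[]. Qed.

Lemma right_dec X t : Dset X ->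
  (exists r, 0 < r /\ forall s, t < s -> s < t + r -> X s) \/
  (exists r, 0 < r /\ forall s, t < s -> s < t + r -> ~ X s).
Proof.
move=> /(at_cut_dec (proper_right t))[h|h]; [left|right]; move: h.
all: move=> [d [e [/= dt /negP]]]; rewrite -ltNge => te h.
all: exists (e - t); split; first lra.
all: by move=> s ts se; apply: h; lra.
Qed.

Lemma left_dec X t : Dset X ->
  (exists r, 0 < r /\ forall s, t - r < s -> s < t -> X s) \/
  (exists r, 0 < r /\ forall s, t - r < s -> s < t -> ~ X s).
Proof.
move=> /(at_cut_dec (proper_left t))[h|h]; [left|right]; move: h.
all: move=> [d [e [/= dt /negP]]]; rewrite -leNgt => te h.
all: exists (t - d); split; first lra.
all: by move=> s ts se; apply: h; lra.
Qed.

(** The dichotomy is applied at the cut generated by [X]. If [X] fills an interval across it, the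
    right endpoint of that interval is the supremum; if [X] avoids one, the left endpoint is the
    largest element of [X]. *)
Lemma Dset_sup X x : Dset X -> X x -> (exists u, forall x, X x -> x <= u) ->
  exists w, is_lub X w.
Proof.
move=> dX Xx Xu.
have pC := proper_below Xx Xu.
have [[d [e [[y Xy dy] Ce h]]]|[d [e [[y Xy dy] Ce h]]]] := at_cut_dec pC dX.
  have Xe z : X z -> z <= e.
    by move=> Xz; rewrite leNgt; apply/negP => ez; apply: Ce; exists z => //; exact: ltW.
  exists e; split=> // u hu; rewrite leNgt; apply/negP => ue.
  have de : d < e by apply: (cut_lt_out pC) => //; exists y.
  set m := (Num.max u d + e) / 2.
  have [ud /andP[dm me]] : u < m /\ d < m < e by rewrite /m; case: (leP u d); lra.
  by have /hu := h m dm me; rewrite leNgt ud.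
have Xd z : X z -> z <= d.
  move=> Xz; rewrite leNgt; apply/negP => dz.
  suff ze : z < e by exact: (h z).
  by rewrite ltNge; apply/negP => ez; apply: Ce; exists z.
have {}dy : d = y by apply/le_anti; rewrite dy Xd.
by exists d; split=> // u; apply; rewrite dy.
Qed.

Lemma Dfun_sup R : Drel R ->
  exists2 f, Dfun f & forall t w, is_lub (R t) w -> is_lub (R t) (f t).
Proof.
move=> dR; pose f t := xget 0 [set w | is_lub (R t) w].
have fP t w : is_lub (R t) w -> is_lub (R t) (f t).
  by move=> h; rewrite /f; case: xgetP => [y -> //|/(_ w)].
exists f => //; apply: (@Dfun_unique _ _ _ (fun t w => is_lub (R t) w)).
- by rewrite /is_lub; definable.
- by move=> t; exact: is_lub_unique.
- by move=> t [w /fP].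
- by move=> t h; rewrite /f; case: xgetP => // y _ hy; case: h; exists y.
Qed.

Lemma Dfun_if (P : set M) f g : Dset P -> Dfun f -> Dfun g ->
  Dfun (fun t => if `[<P t>] then f t else g t).
Proof.
move=> dP df dg.
apply: (@Dpred_ext _ _ _ (fun x => (P (x 1%N) /\ x 0%N = f (x 1%N)) \/
   (~ P (x 1%N) /\ x 0%N = g (x 1%N)))).
  by move=> x; case: asboolP; tauto.
by definable.
Qed.

(* The chosen point is the infimum a of R t if it belongs to R t, and otherwise
   the midpoint of (a, b), for the largest b <= a + 1 with (a, b) inside R t. *)
Lemma Dchoice_ge0 R : Drel R -> (forall t y, R t y -> 0 <= y) ->
  exists2 f, Dfun f & forall t, (exists y, R t y) -> R t (f t).
Proof.
move=> dR R0.
(* The infimum is obtained as a supremum of lower bounds, among which nonnegativity provides 0. *)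
pose A t y := forall z, R t z -> y <= z.
have [|a da aP] := @Dfun_sup A; first by rewrite /A; definable.
pose B t y := y <= a t + 1 /\ forall z, a t < z -> z < y -> R t z.
have [|b db bP] := @Dfun_sup B; first by rewrite /B; definable.
exists (fun t => if `[<R t (a t)>] then a t else (a t + b t) * 2^-1).
  by apply: Dfun_if; definable.
move=> t [y Ry]; case: asboolP => // nRa.
have dRt : Dset (R t) by definable.
have [a1 a2] : is_lub (A t) (a t).
  have [|||w /aP//] := @Dset_sup (A t) 0.
  - by rewrite /A; definable.
  - by move=> z /R0.
  - by exists y => x; exact.
have alb z : R t z -> a t <= z by move=> Rz; apply: a2 => x; exact.
have [b1 b2] : is_lub (B t) (b t).
  have [|||w /bP//] := @Dset_sup (B t) (a t).
  - by rewrite /B; definable.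
  - by split; [lra|move=> z az za; have := lt_trans az za; rewrite ltxx].
  - by exists (a t + 1) => x [].
have ab : a t < b t.
  have [[r [r0 hr]]|[r [r0 hr]]] := right_dec (a t) dRt.
    suff: a t + Num.min r 1 <= b t by case: (leP r 1); lra.
    apply: b1; split; first by case: (leP r 1); lra.
    by move=> z az zr; apply: hr => //; move: zr; case: (leP r 1); lra.
  have: a t + r <= a t; last lra.
  apply: a1 => z Rz; rewrite leNgt; apply/negP => zr.
  apply: (hr z) => //; have := alb _ Rz; rewrite le_eqVlt => /orP[/eqP az|//].
  by rewrite -az in Rz.
have [c [_ hc] mc] : exists2 c, B t c & (a t + b t) * 2^-1 < c.
  by apply: is_lub_gt; [split; [exact: b1|exact: b2]|lra].
by apply: hc => //; lra.
Qed.

Lemma Dchoice R : Drel R ->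
  exists2 f, Dfun f & forall t, (exists y, R t y) -> R t (f t).
Proof.
move=> dR.
have [||f df hf] := @Dchoice_ge0 (fun t y => R t y /\ 0 <= y).
- by definable.
- by move=> t y [].
have [||g dg hg] := @Dchoice_ge0 (fun t y => R t (- y) /\ 0 <= y).
- by definable.
- by move=> t y [].
exists (fun t => if `[<exists y, R t y /\ 0 <= y>] then f t else - g t).
  by apply: Dfun_if; definable.
move=> t [y Ry]; case: asboolP => [/hf[]//|n].
have [|] := hg t; last by [].
exists (- y); rewrite opprK; split=> //.
by rewrite oppr_ge0 leNgt; apply/negP => /ltW y0; apply: n; exists y.
Qed.

End OMinimal.

(** * Definable functions near an unfilled cut *)

Section Gaps.
Variables (L : language) (M : rcfType) (S : structure L M).
Hypothesis omin : o_minimal S.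
Implicit Types (C X Y : set M).
Local Notation Dset := (Dset S).
Local Notation Drel := (Drel S).
Local Notation Dfun := (Dfun S).

(* The points t of (d, e) such that beta is smaller than beta t on (t, e) are
   cofinal in (d, e), because each set {beta >= r} has a maximum unless it
   contains an interval; by o-minimality they fill up an interval, on which beta
   is then decreasing. *)
Lemma locally_bounded_below (beta : M -> M) d e : Dfun beta -> d < e ->
  (forall t, d < t -> t < e -> 0 < beta t) ->
  exists d' e' r, [/\ d <= d', d' < e', e' <= e, 0 < r
    & forall t, d' < t -> t < e' -> r <= beta t].
Proof.
move=> db de b0; apply: contrapT => hn.
pose D r t := [/\ d < t, t < e & r <= beta t].
have Dmax r x : 0 < r -> D r x ->
    exists w, [/\ D r w, x <= w & forall t, D r t -> t <= w].
  move=> r0 Dx; have dD : Dset (fun t => d < t /\ t < e /\ r <= beta t) by definable.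
  have DE t : (d < t /\ t < e /\ r <= beta t) <-> D r t by split=> [[?[]]|[]].
  have {}dD : Dset (D r) by apply: Dpred_ext dD => y.
  have [|w wP] := Dset_sup omin dD Dx; first by exists e => y [_ /ltW].
  have [w1 w2] := wP.
  suff Dw : D r w by exists w; split=> //; exact: w1.
  have we : w <= e by apply: w2 => y [_ /ltW].
  have xw := w1 _ Dx; have [dx _ _] := Dx.
  have [[r' [r'0 h]]|[r' [r'0 h]]] := left_dec omin w dD.
    case: hn; exists (Num.max d (w - r')), w, r; split=> //.
    - by case: (leP d (w - r')); lra.
    - by case: (leP d (w - r')); lra.
    - by move=> t; rewrite gt_max => /andP[_ t1] t2; have [] := h t t1 t2.
  have [|y Dy wy] := is_lub_gt wP (u := w - r'); first lra.
  have := w1 _ Dy; rewrite le_eqVlt => /orP[/eqP <- //|yw].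
  by case: (h _ wy yw).
pose Y t := d < t /\ t < e /\ forall t', t < t' -> t' < e -> beta t' < beta t.
have dY : Dset Y by rewrite /Y; definable.
have Ycof x : d < x -> x < e -> exists2 t, Y t & x <= t.
  move=> dx xe; have [|w [[dw we bw] xw wP]] := Dmax (beta x) x (b0 x dx xe).
    by split.
  exists w => //; split=> //; split=> // t' wt te.
  apply: lt_le_trans bw; rewrite ltNge; apply/negP => bt.
  have : t' <= w by apply: wP; split=> //; exact: lt_trans wt.
  by rewrite leNgt wt.

have [[r [r0 h]]|[r [r0 h]]] := left_dec omin e dY.
  set d' := Num.max d (e - r); have d'e : d' < e.
    by rewrite /d'; case: (leP d (e - r)); lra.
  have dd' : d <= d' by rewrite /d'; case: (leP d (e - r)); lra.
  have rd' : e - r <= d' by rewrite /d'; case: (leP d (e - r)); lra.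
  case: hn; exists d', ((d' + e) / 2), (beta ((d' + e) / 2)); split=> //; try lra.
    by apply: b0; lra.
  move=> t t1 t2; have [||_ [_ hY]] := h t; try lra.
  by apply: ltW; apply: hY; lra.
set x := (Num.max d (e - r) + e) / 2.
have [||t [dt [te Yt]] xt] := Ycof x.
- by rewrite /x; case: (leP d (e - r)); lra.
- by rewrite /x; case: (leP d (e - r)); lra.
apply: (h t) => //; move: xt; rewrite /x; case: (leP d (e - r)); lra.
Qed.

(** A radius that depends on the point is chosen definably, and the choice function is bounded below
    on a subinterval. *)
Lemma uniform_on_subinterval (R : M -> M -> Prop) d e : Drel R -> d < e ->
  (forall t, d < t -> t < e -> exists2 r, 0 < r & R t r) ->
  exists d' e' r0, [/\ d <= d', d' < e', e' <= e, 0 < r0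
    & forall t, d' < t -> t < e' -> exists2 r, r0 <= r & R t r].
Proof.
move=> dR de hR.
have [|f df fP] := @Dchoice _ _ S omin (fun t r => 0 < r /\ R t r).
  by definable.
have fP' t : d < t -> t < e -> 0 < f t /\ R t (f t).
  by move=> dt te; have [r r0 Rr] := hR t dt te; apply: fP; exists r.
have [|d' [e' [r0 [dd' d'e' e'e r00 h]]]] := locally_bounded_below df de.
  by move=> t dt te; have [] := fP' t dt te.
exists d', e', r0; split=> // t t1 t2; exists (f t); first exact: h.
by have [] := fP' t (le_lt_trans dd' t1) (lt_le_trans t2 e'e).
Qed.

Definition gap C := [/\ proper_cut C, forall x, C x -> exists2 y, C y & x < y
  & forall x, ~ C x -> exists2 y, ~ C y & y < x].

(** The subinterval given by [locally_bounded_below] may miss the cut. The set [G] of points with a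
    local lower bound repairs this: it must contain an interval across the cut, and local bounds are
    glued there by a definable compactness argument. *)
Lemma bounded_below_at_gap (beta : M -> M) C : Dfun beta -> gap C ->
  at_cut C (fun t => 0 < beta t) ->
  exists2 r, 0 < r & at_cut C (fun t => r <= beta t).
Proof.
move=> db [pC Cmax Cmin] [d [e [Cd Ce b0]]].
pose G t := exists r, 0 < r /\ forall s, t - r < s -> s < t + r -> r <= beta s.
have dG : Dset G by rewrite /G; definable.
have [[d1 [e1 [Cd1 Ce1 hG]]]|[d1 [e1 [Cd1 Ce1 hG]]]] := at_cut_dec omin pC dG.
  (* The gap leaves room for a closed interval [d2, e2] inside (d1, e1) that still straddles the
     cut. *)
  have [d2 Cd2 d12] := Cmax _ Cd1; have [e2 Ce2 e12] := Cmin _ Ce1.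
  have de2 := cut_lt_out pC Cd2 Ce2.
  pose W x := d2 <= x /\ x <= e2 /\
    exists r, 0 < r /\ forall s, d2 <= s -> s <= x -> r <= beta s.
  have dW : Dset W by rewrite /W; definable.
  have Wd2 : W d2.
    split=> //; split; first exact: ltW.
    have [||r [r0 hr]] := hG d2; [lra|lra|exists r; split=> // s s1 s2].
    by apply: hr; lra.
  have [|w wW] := Dset_sup omin dW Wd2; first by exists e2 => x [_ []].
  have [w1 w2] := wW.
  have dw := w1 _ Wd2; have we : w <= e2 by apply: w2 => x [_ []].
  have [||r [r0 hr]] := hG w; [lra|lra|].
  have [|x [d2x [xe2 [r' [r'0 hr']]]] wx] := is_lub_gt wW (u := w - r).
    by lra.
  (* Heine-Borel by a supremum: the bound [r'] holds up to some [x] beyond [w - r], and the bound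
     [r] from there to beyond [w]. Their minimum carries [W] past [w], unless [e2] is reached. *)
  have [_ [_ [r2 [r20 h2]]]] : W e2.
    have [we2|] := leP e2 (w + r / 2); last first.
      move=> we2; have: w + r / 2 <= w; last lra.
      apply: w1; split; first lra.
      split; first exact: ltW.
      exists (Num.min r r'); split; first by rewrite lt_min r0.
      move=> s s1 s2; rewrite ge_min.
      have [sx|sx] := leP s x; first by rewrite hr' ?orbT.
      by rewrite hr //; lra.
    split; first exact: ltW.
    split => //; exists (Num.min r r'); split; first by rewrite lt_min r0.
    move=> s s1 s2; rewrite ge_min.
    have [sx|sx] := leP s x; first by rewrite hr' ?orbT.
    by rewrite hr //; lra.
  exists r2 => //; exists d2, e2; split=> // s s1 s2.
  by apply: h2; exact: ltW.
(* Here no point near the cut has a local bound, but the midpoint of the subinterval obtained now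
   has one. *)
have [||d' [e' [r [dd' d'e' e'e r0 hr]]]] :=
  @locally_bounded_below beta (Num.max d d1) (Num.min e e1) db.
- by rewrite gt_max !lt_min !(cut_lt_out pC).
- by move=> t; rewrite gt_max lt_min => /andP[? _] /andP[? _]; exact: b0.
move: dd' e'e; rewrite ge_max le_min => /andP[_ d1d'] /andP[_ e'e1].
case: (hG ((d' + e') / 2)); [lra|lra|].
exists (Num.min r ((e' - d') / 2)); split; first by rewrite lt_min r0; lra.
move=> s s1 s2; rewrite ge_min hr //.
- by move: s1; case: (leP r ((e' - d') / 2)); lra.
- by move: s2; case: (leP r ((e' - d') / 2)); lra.
Qed.

Lemma uniform_at_gap (R : M -> M -> Prop) C : Drel R -> gap C ->
  at_cut C (fun t => exists2 r, 0 < r & R t r) ->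
  exists2 r0, 0 < r0 & at_cut C (fun t => exists2 r, r0 <= r & R t r).
Proof.
move=> dR gC hR; have [pC _ _] := gC.
have [|f df fP] := @Dchoice _ _ S omin (fun t r => 0 < r /\ R t r).
  by definable.
have {}hR : at_cut C (fun t => 0 < f t /\ R t (f t)).
  by apply: at_cut_mono hR => t [r r0 Rr]; apply: fP; exists r.
have [|r r0 hr] := bounded_below_at_gap df gC.
  by apply: at_cut_mono hR => t [].
exists r => //; apply: at_cut_mono (at_cutI pC hr hR) => t [rt [_ Rt]].
by exists (f t).
Qed.

(* By o-minimality the image of f would contain an interval, but its points are
   eps-separated. *)
Lemma not_everywhere_jumping (f : M -> M) d e eps : Dfun f -> d < e -> 0 < eps ->
  (forall s t, d < s -> s < t -> t < e -> f s + eps < f t) -> False.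
Proof.
move=> df de eps0 hf.
(* Only values on the left half are collected, so that [f t0] bounds them above and the cut they
   generate is proper. *)
set t0 := (d + e) / 2.
pose Y y := exists s, d < s /\ s < t0 /\ y = f s.
have dY : Dset Y by rewrite /Y; definable.
have Yx : Y (f ((d + t0) / 2)).
  by exists ((d + t0) / 2); rewrite /t0; split; [|split]; lra.
have Yub : exists u, forall y, Y y -> y <= u.
  exists (f t0) => y [s [ds [st ->]]].
  by have := hf s t0 ds st; rewrite /t0 in st *; lra.
have pC := proper_below Yx Yub.
set C := [set y | exists2 x, Y x & y <= x] in pC.
have Ynext s e' : d < s -> s < t0 -> ~ C e' -> f s + eps < f ((s + t0) / 2) < e'.
  move=> ds st Ce'; rewrite hf //=; try by rewrite /t0 in st *; lra.
  apply: (cut_lt_out pC) => //; exists (f ((s + t0) / 2)) => //.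
  by exists ((s + t0) / 2); split; [|split]; lra.
have [] := at_cut_dec omin pC dY;
  move=> [d1 [e1 [[y [s [ds [st ->]]] d1s] Ce1 h]]].
  have /andP[fs1 fs2] := Ynext s e1 ds st Ce1.
  have [||s' [ds' [st' fs']]] := h (f s + eps / 2); [lra|lra|].
  have [ss|ss|ss] := ltgtP s s'.
  - by have := hf s s' ds ss; rewrite /t0 in st' *; lra.
  - by have := hf s' s ds' ss; rewrite /t0 in st *; lra.
  - by rewrite -ss in fs'; lra.
have /andP[fs1 fs2] := Ynext s e1 ds st Ce1.
apply: (h (f ((s + t0) / 2))) => //; first lra.
by exists ((s + t0) / 2); split; [|split]; lra.
Qed.

Definition jumps_right eps (f : M -> M) t :=
  exists r, 0 < r /\ forall s, t < s -> s < t + r -> f t + eps < f s.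

Definition jumps_left eps (f : M -> M) t :=
  exists r, 0 < r /\ forall s, t - r < s -> s < t -> f t + eps < f s.

Lemma Dset_jumps eps f : Dfun f ->
  Dset (jumps_right eps f) /\ Dset (jumps_left eps f).
Proof.
by move=> df; split; rewrite /jumps_right /jumps_left; definable.
Qed.

Lemma not_jumps_right eps f C : Dfun f -> proper_cut C -> 0 < eps ->
  ~ at_cut C (jumps_right eps f).
Proof.
move=> df pC eps0 [d [e [Cd Ce h]]].
have [|||d' [e' [r0 [dd' d'e' e'e r00 h']]]] := @uniform_on_subinterval
  (fun t r => forall s, t < s -> s < t + r -> f t + eps < f s) d e.
- by definable.
- exact: (cut_lt_out pC).
- by move=> t dt te; have [r []] := h t dt te; exists r.
(* On an interval of length at most [r0], every later point lies within the jump radius of every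
   earlier one. *)
apply: (@not_everywhere_jumping f d' (Num.min e' (d' + r0)) eps) => //.
  by rewrite lt_min d'e'; lra.
move=> s t ds st; rewrite lt_min => /andP[te tr].
by have [||r r0r] := h' s; [lra|lra|apply; lra].
Qed.

Lemma not_jumps_left eps f C : Dfun f -> proper_cut C -> 0 < eps ->
  ~ at_cut C (jumps_left eps f).
Proof.
move=> df pC eps0 [d [e [Cd Ce h]]].
have [|||d' [e' [r0 [dd' d'e' e'e r00 h']]]] := @uniform_on_subinterval
  (fun t r => forall s, t - r < s -> s < t -> f t + eps < f s) d e.
- by definable.
- exact: (cut_lt_out pC).
- by move=> t dt te; have [r []] := h t dt te; exists r.
(* Jumping up to the left means decreasing by more than [eps], so the opposite function is the
   increasing one. *)
apply: (@not_everywhere_jumping (fun t => - f t) d' (Num.min e' (d' + r0)) eps) => //.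
- by definable.
- by rewrite lt_min d'e'; lra.
move=> s t ds st; rewrite lt_min => /andP[te tr].
have [||r r0r hr] := h' t; [lra|lra|].
by have := hr s ltac:(lra) st; lra.
Qed.

Definition cauchy_cut C :=
  forall eps, 0 < eps -> exists d e, [/\ C d, ~ C e & e - d < eps].

Lemma small_oscillation_at_gap C (f : M -> M) eps :
  gap C -> cauchy_cut C -> Dfun f -> 0 < eps ->
  exists d e, [/\ C d, ~ C e &
    forall s t, d < s -> s < e -> d < t -> t < e -> f s <= f t + eps].
Proof.
move=> gC cC df eps0; have [pC _ _] := gC.
have dnf : Dfun (fun t => - f t) by definable.
have [d1 d2] := Dset_jumps eps df; have [d3 d4] := Dset_jumps eps dnf.
pose R t r := forall s, t - r < s -> s < t + r -> f s <= f t + eps /\ f t <= f s + eps.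
have [||r0 r00] := @uniform_at_gap R C _ gC.
- by rewrite /R; definable.
- have := at_cutI pC (at_cutI pC (at_cutNE omin pC d1 (not_jumps_right df pC eps0))
    (at_cutNE omin pC d2 (not_jumps_left df pC eps0)))
   (at_cutI pC (at_cutNE omin pC d3 (not_jumps_right dnf pC eps0))
    (at_cutNE omin pC d4 (not_jumps_left dnf pC eps0))).
  apply: at_cut_mono => t [[n1 n2] [n3 n4]].
  have dX : Dset (fun s => f t + eps < f s) by definable.
  have dX' : Dset (fun s => - f t + eps < - f s) by definable.
  have [//|[r1 [r10 h1]]] := right_dec omin t dX.
  have [//|[r2 [r20 h2]]] := left_dec omin t dX.
  have [//|[r3 [r30 h3]]] := right_dec omin t dX'.
  have [//|[r4 [r40 h4]]] := left_dec omin t dX'.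
  set r := Num.min (Num.min r1 r2) (Num.min r3 r4).
  have rr : [/\ r <= r1, r <= r2, r <= r3 & r <= r4].
    by rewrite /r !ge_min !lexx ?orbT.
  have [rr1 rr2 rr3 rr4] := rr.
  exists r; first by rewrite /r !lt_min r10 r20 r30.
  move=> s s1 s2; have [st|st|->] := ltgtP s t; last by lra.
  + have /negP := h2 s ltac:(lra) st; have /negP := h4 s ltac:(lra) st.
    by rewrite -!leNgt; lra.
  + have /negP := h1 s st ltac:(lra); have /negP := h3 s st ltac:(lra).
    by rewrite -!leNgt; lra.
(* All radii are at least [r0] near the cut; an interval across it shorter than [r0] lies within the
   radius of each of its points. *)
move=> [d [e [Cd Ce h]]]; have [d' [e' [Cd' Ce' de']]] := cC r0 r00.
exists (Num.max d d'), (Num.min e e'); split.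
- by case: (leP d d').
- by case: (leP e e').
move=> s t; rewrite !gt_max !lt_min.
move=> /andP[s1 s2] /andP[s3 s4] /andP[t1 t2] /andP[t3 t4].
have [r r0r hr] := h t t1 t3.
by have [] := hr s ltac:(lra) ltac:(lra).
Qed.

(** This is the density of [M] in the field of germs, expressed with representatives. *)
Lemma constant_between_at_gap C (f g : M -> M) :
  gap C -> cauchy_cut C -> Dfun f -> Dfun g -> at_cut C (fun s => f s < g s) ->
  exists c, at_cut C (fun s => f s < c /\ c < g s).
Proof.
move=> gC cC df dg fg; have [pC _ _] := gC.
have [||r r0 hr] := @bounded_below_at_gap (fun t => g t - f t) C _ gC.
- by definable.
- by apply: at_cut_mono fg => s; rewrite subr_gt0.
have [|d [e [Cd Ce h]]] := @small_oscillation_at_gap C f (r / 4) gC cC df.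
  by lra.
have de := cut_lt_out pC Cd Ce.
(* Near the cut [f] stays within r/4 of its value at the midpoint while [g] exceeds [f] by at least
   r, so adding r/2 lands strictly between them. *)
exists (f ((d + e) / 2) + r / 2).
have hde : at_cut C (fun s => d < s /\ s < e) by exists d, e; split.
apply: at_cut_mono (at_cutI pC hr hde) => s [rs [ds se]].
have := h s ((d + e) / 2) ds se ltac:(lra) ltac:(lra).
have := h ((d + e) / 2) s ltac:(lra) ltac:(lra) ds se.
by split; lra.
Qed.

End Gaps.

(** * The definable ultrapower at a cut *)

Local Open Scope quotient_scope.

Record dfun (L : language) (M : rcfType) (S : structure L M) := DFun {
  dfun_val :> M -> M;
  dfunP : Dfun S dfun_val }.

Section DfunChoice.
Variables (L : language) (M : rcfType) (S : structure L M).
HB.instance Definition _ := gen_eqMixin (dfun S).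
HB.instance Definition _ := gen_choiceMixin (dfun S).
End DfunChoice.

(** Inversion is not a symbol of [term]: its graph is given by the equation xy = 1, completed by the
    convention that 0 is its own inverse. *)
Lemma Dinv (L : language) (M : rcfType) (S : structure L M) t :
  Dterm S t -> Dterm S (fun x => (t x)^-1).
Proof.
move=> dt; have df : Dfun S GRing.inv.
  apply: (@Dpred_ext _ _ _ (fun x => x 1%N = 0 /\ x 0%N = 0 \/
     x 0%N * x 1%N = 1)).
    move=> x; split=> [[[-> ->]|h]|->].
    - by rewrite invr0.
    - have x0 : x 1%N != 0.
        by apply: contra_eqN h => /eqP ->; rewrite mulr0 eq_sym oner_eq0.
      by rewrite -[LHS](mulfK x0) h mul1r.
    - have [->|x0] := eqVneq (x 1%N) 0; [by left; rewrite invr0|right].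
      exact: mulVf.
  by definable.
exact: Dapp.
Qed.

Section Germs.
Variables (L : language) (M : rcfType) (S : structure L M).
Hypothesis omin : o_minimal S.
Variable C : set M.
Hypothesis pC : proper_cut C.
Local Notation D := (dfun S).
Implicit Types f g : D.

Definition germ_eq f g : bool := `[<at_cut C (fun s => f s = g s)>].

Lemma germ_eq_refl : reflexive germ_eq.
Proof. by move=> f; apply/asboolP; exact: at_cutT. Qed.

Lemma germ_eq_sym : symmetric germ_eq.
Proof. by move=> f g; apply/asboolP/asboolP; apply: at_cut_mono. Qed.

Lemma germ_eq_trans : transitive germ_eq.
Proof.
move=> g f h /asboolP fg /asboolP gh; apply/asboolP.
by apply: at_cut_mono (at_cutI pC fg gh) => s [->].
Qed.

Canonical germ_equiv := EquivRel germ_eq germ_eq_refl germ_eq_sym germ_eq_trans.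

Definition germ := {eq_quot germ_eq}.
HB.instance Definition _ : EqQuotient _ germ_eq germ := EqQuotient.on germ.
HB.instance Definition _ := Choice.on germ.

Definition mk f : germ := \pi_germ f.
Definition rep (x : germ) : D := repr x.

Lemma repK x : mk (rep x) = x. Proof. exact: reprK. Qed.

Lemma mk_eq f g : mk f = mk g <-> at_cut C (fun s => f s = g s).
Proof. by split=> [/eqmodP/asboolP|h]; last exact/eqmodP/asboolP. Qed.

Lemma rep_mk f : at_cut C (fun s => rep (mk f) s = f s).
Proof. by apply/mk_eq; rewrite repK. Qed.

Lemma germP x y : at_cut C (fun s => rep x s = rep y s) -> x = y.
Proof. by move=> /mk_eq; rewrite !repK. Qed.

Lemma Dadd_dfun f g : Dfun S (fun s => f s + g s).
Proof. have := dfunP f; have := dfunP g; by definable. Qed.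
Lemma Dmul_dfun f g : Dfun S (fun s => f s * g s).
Proof. have := dfunP f; have := dfunP g; by definable. Qed.
Lemma Dopp_dfun f : Dfun S (fun s => - f s).
Proof. have := dfunP f; by definable. Qed.
Lemma Dinv_dfun f : Dfun S (fun s => (f s)^-1).
Proof. exact: Dinv (dfunP f). Qed.
Lemma Dcst_dfun c : Dfun S (fun _ => c).
Proof. exact: Dcst. Qed.
Lemma Did_dfun : Dfun S (fun s => s).
Proof. exact: Dvar. Qed.

Definition gcst c := mk (DFun (Dcst_dfun c)).
Definition gadd x y := mk (DFun (Dadd_dfun (rep x) (rep y))).
Definition gmul x y := mk (DFun (Dmul_dfun (rep x) (rep y))).
Definition gopp x := mk (DFun (Dopp_dfun (rep x))).
Definition ginv x := mk (DFun (Dinv_dfun (rep x))).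

Lemma rep_cst c : at_cut C (fun s => rep (gcst c) s = c).
Proof. exact: rep_mk. Qed.
Lemma rep_add x y : at_cut C (fun s => rep (gadd x y) s = rep x s + rep y s).
Proof. exact: rep_mk. Qed.
Lemma rep_mul x y : at_cut C (fun s => rep (gmul x y) s = rep x s * rep y s).
Proof. exact: rep_mk. Qed.
Lemma rep_opp x : at_cut C (fun s => rep (gopp x) s = - rep x s).
Proof. exact: rep_mk. Qed.
Lemma rep_inv x : at_cut C (fun s => rep (ginv x) s = (rep x s)^-1).
Proof. exact: rep_mk. Qed.

(** Representatives of sums, products and the like have the expected values only near the cut. This
    chains such facts until an identity of germs becomes a pointwise computation in [M]. *)
Lemma at_cut_imp X Y : at_cut C X -> at_cut C (fun s => X s -> Y s) -> at_cut C Y.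
Proof. by move=> h /(at_cutI pC h); apply: at_cut_mono => s [? ]; apply. Qed.

Lemma gaddA : associative gadd.
Proof.
move=> x y z; apply: germP.
apply: (at_cut_imp (rep_add x (gadd y z))); apply: (at_cut_imp (rep_add y z)).
apply: (at_cut_imp (rep_add (gadd x y) z)); apply: at_cut_mono (rep_add x y).
by move=> s -> -> -> ->; rewrite addrA.
Qed.

Lemma gaddC : commutative gadd.
Proof.
move=> x y; apply: germP; apply: (at_cut_imp (rep_add x y)).
by apply: at_cut_mono (rep_add y x) => s -> ->; rewrite addrC.
Qed.

Lemma gadd0 : left_id (gcst 0) gadd.
Proof.
move=> x; apply: germP; apply: (at_cut_imp (rep_add (gcst 0) x)).
by apply: at_cut_mono (rep_cst 0) => s -> ->; rewrite add0r.
Qed.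

Lemma gaddN : left_inverse (gcst 0) gopp gadd.
Proof.
move=> x; apply: germP; apply: (at_cut_imp (rep_add (gopp x) x)).
apply: (at_cut_imp (rep_opp x)).
by apply: at_cut_mono (rep_cst 0) => s -> -> ->; rewrite addNr.
Qed.

HB.instance Definition _ := GRing.isZmodule.Build germ gaddA gaddC gadd0 gaddN.

Lemma gmulA : associative gmul.
Proof.
move=> x y z; apply: germP.
apply: (at_cut_imp (rep_mul x (gmul y z))); apply: (at_cut_imp (rep_mul y z)).
apply: (at_cut_imp (rep_mul (gmul x y) z)); apply: at_cut_mono (rep_mul x y).
by move=> s -> -> -> ->; rewrite mulrA.
Qed.

Lemma gmulC : commutative gmul.
Proof.
move=> x y; apply: germP; apply: (at_cut_imp (rep_mul x y)).
by apply: at_cut_mono (rep_mul y x) => s -> ->; rewrite mulrC.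
Qed.

Lemma gmul1 : left_id (gcst 1) gmul.
Proof.
move=> x; apply: germP; apply: (at_cut_imp (rep_mul (gcst 1) x)).
by apply: at_cut_mono (rep_cst 1) => s -> ->; rewrite mul1r.
Qed.

Lemma gmulDl : left_distributive gmul gadd.
Proof.
move=> x y z; apply: germP.
apply: (at_cut_imp (rep_mul (gadd x y) z)); apply: (at_cut_imp (rep_add x y)).
apply: (at_cut_imp (rep_add (gmul x z) (gmul y z))).
apply: (at_cut_imp (rep_mul x z)); apply: at_cut_mono (rep_mul y z).
by move=> s -> -> -> -> ->; rewrite mulrDl.
Qed.

Lemma gcst1_neq0 : gcst 1 != gcst 0.
Proof.
apply/eqP => /mk_eq/(at_cut_ex pC)[s] /= /eqP.
by rewrite oner_eq0.
Qed.

HB.instance Definition _ :=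
  GRing.Zmodule_isComNzRing.Build germ gmulA gmulC gmul1 gmulDl gcst1_neq0.

Lemma Dset_rel (R : M -> M -> Prop) x y : Drel S R ->
  Dset S (fun s => R (rep x s) (rep y s)).
Proof.
have := dfunP (rep x); have := dfunP (rep y) => dx dy dR; by definable.
Qed.

(** By the dichotomy, a nonzero germ is nonzero at every point of some interval across the cut,
    where pointwise inversion works. *)
Lemma gmulV x : x != 0 -> gmul (ginv x) x = gcst 1.
Proof.
move=> /eqP x0; apply: germP; apply: (at_cut_imp (rep_mul (ginv x) x)).
apply: (at_cut_imp (rep_inv x)); apply: (at_cut_imp (rep_cst 1)).
have [h|] := at_cut_dec omin pC (@Dset_rel eq x 0 ltac:(definable)).
  by case: x0; exact: germP.
move=> h; apply: (at_cut_imp h); apply: at_cut_mono (rep_cst 0).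
by move=> s h0 /eqP xs -> -> ->; rewrite mulVf // -h0.
Qed.

Lemma ginv0 : ginv 0 = 0.
Proof.
apply: germP; apply: (at_cut_imp (rep_inv 0)).
by apply: at_cut_mono (rep_cst 0) => s h ->; rewrite h invr0.
Qed.

HB.instance Definition _ := GRing.ComNzRing_isField.Build germ gmulV ginv0.

Definition gle (x y : germ) : bool := `[<at_cut C (fun s => rep x s <= rep y s)>].
Definition glt (x y : germ) : bool := `[<at_cut C (fun s => rep x s < rep y s)>].
Definition gnorm (x : germ) : germ := if gle 0 x then x else - x.

Lemma gle0P x : reflect (at_cut C (fun s => 0 <= rep x s)) (gle 0 x).
Proof.
apply: (iffP (asboolP _)) => h; apply: (at_cut_imp h);
  by apply: at_cut_mono (rep_cst 0) => s ->.
Qed.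

Lemma gle_total x y : gle x y || gle y x.
Proof.
have [h|h] := at_cut_dec omin pC (@Dset_rel (fun u v => u <= v) x y ltac:(definable)).
  by apply/orP; left; apply/asboolP.
apply/orP; right; apply/asboolP; apply: at_cut_mono h => s /negP.
by rewrite -ltNge => /ltW.
Qed.

Lemma gle0_add x y : gle 0 x -> gle 0 y -> gle 0 (x + y).
Proof.
move=> /gle0P x0 /gle0P y0; apply/gle0P; apply: (at_cut_imp (rep_add x y)).
by apply: at_cut_mono (at_cutI pC x0 y0) => s [? ?] ->; exact: addr_ge0.
Qed.

Lemma gle0_mul x y : gle 0 x -> gle 0 y -> gle 0 (x * y).
Proof.
move=> /gle0P x0 /gle0P y0; apply/gle0P; apply: (at_cut_imp (rep_mul x y)).
by apply: at_cut_mono (at_cutI pC x0 y0) => s [? ?] ->; exact: mulr_ge0.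
Qed.

Lemma gle_anti x y : gle x y -> gle y x -> x = y.
Proof.
move=> /asboolP xy /asboolP yx; apply: germP.
by apply: at_cut_mono (at_cutI pC xy yx) => s [? ?]; apply/le_anti/andP.
Qed.

Lemma gle0_anti x : gle 0 x -> gle x 0 -> x = 0.
Proof. by move=> ? ?; exact: gle_anti. Qed.

Lemma gsub_ge0 x y : gle 0 (y - x) = gle x y.
Proof.
apply/gle0P/asboolP => h; apply: (at_cut_imp h);
  apply: (at_cut_imp (rep_add y (- x)));
  by apply: at_cut_mono (rep_opp x) => s -> ->; rewrite subr_ge0.
Qed.

Lemma gle0_total x : gle 0 x || gle x 0.
Proof. exact: gle_total. Qed.

Lemma gnormN x : gnorm (- x) = gnorm x.
Proof.
have e : gle 0 (- x) = gle x 0 by rewrite -sub0r gsub_ge0.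
rewrite /gnorm e opprK.
case: (boolP (gle x 0)) => x0; case: (boolP (gle 0 x)) => x0' //.
  by rewrite (gle_anti x0 x0') oppr0.
by have := gle0_total x; rewrite (negbTE x0') (negbTE x0).
Qed.

Lemma gge0_norm x : gle 0 x -> gnorm x = x.
Proof. by rewrite /gnorm => ->. Qed.

Lemma glt_def x y : glt x y = (y != x) && gle x y.
Proof.
apply/asboolP/andP => [h|[/eqP yx /asboolP h]].
  split; last by apply/asboolP; apply: at_cut_mono h => s /ltW.
  apply/eqP => yx; rewrite yx in h.
  by have [s] := at_cut_ex pC h; rewrite ltxx.
have [e|] := at_cut_dec omin pC (@Dset_rel eq x y ltac:(definable)).
  by case: yx; rewrite (germP e).
move=> n; apply: at_cut_mono (at_cutI pC n h) => s [/eqP xy].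
by rewrite lt_neqAle xy.
Qed.

HB.instance Definition _ := Num.IntegralDomain_isLeReal.Build germ
  gle0_add gle0_mul gle0_anti
  gsub_ge0 gle0_total gnormN gge0_norm glt_def.

(** A bare list and not a polynomial, since the leading entry may vanish at particular [s]. *)
Definition coefs_at (cs : seq germ) s : seq M := [seq rep c s | c : germ <- cs].

Lemma rep_horner cs x :
  at_cut C (fun s => rep (horner_rec cs x) s = horner_rec (coefs_at cs s) (rep x s)).
Proof.
elim: cs => [|c cs IH] /=; first exact: rep_cst.
apply: (at_cut_imp IH); apply: (at_cut_imp (rep_mul (horner_rec cs x) x)).
by apply: at_cut_mono (rep_add (horner_rec cs x * x) c) => s -> -> ->.
Qed.

Lemma Dhorner cs : Dterm S (fun v => horner_rec (coefs_at cs (v 0%N)) (v 1%N)).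
Proof.
elim: cs => [|c cs IH] /=; first exact: Dcst.
apply: Dadd; first by apply: Dmul; [exact: IH|exact: Dvar].
by apply: Dapp; [exact: dfunP|exact: Dvar].
Qed.

(** The intermediate value property of [M] gives a root at each point near the cut, and definable
    choice assembles these roots into one germ. *)
Lemma germ_ivt : Num.real_closed_axiom germ.
Proof.
move=> p a b ab /andP[pa pb].
have [|f df fP] := @Dchoice _ _ S omin (fun s y => (rep a s <= y /\ y <= rep b s) /\
  horner_rec (coefs_at p s) y = 0).
- have := dfunP (rep a); have := dfunP (rep b) => db da.
  apply: Dand; first by definable.
  by apply: Deq; [exact: (Dhorner p)|exact: Dcst].
have {}fP : at_cut C (fun s => (rep a s <= f s /\ f s <= rep b s) /\
  horner_rec (coefs_at p s) (f s) = 0).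
  apply: (at_cut_imp (asboolW ab)).
  apply: (at_cut_imp (asboolW pa)); apply: (at_cut_imp (asboolW pb)).
  apply: (at_cut_imp (rep_horner p a)); apply: (at_cut_imp (rep_horner p b)).
  apply: at_cut_mono (rep_cst 0) => s r0 rb ra pb' pa' ab'.
  apply: fP; move: pa' pb'; rewrite /horner ra rb -!horner_Poly r0.
  set q := Poly _ => pa' pb'.
  have [|y /andP[ay yb] /rootP q0] := @poly_ivt M q _ _ ab'; first by rewrite pa'.
  by exists y; rewrite -horner_Poly.
have mkf := rep_mk (DFun df); set x := mk (DFun df) in mkf.
exists x.
  apply/andP; split; apply/asboolP; apply: (at_cut_imp fP);
  by apply: at_cut_mono mkf => s -> [[]].
apply/rootP/germP; apply: (at_cut_imp fP); apply: (at_cut_imp mkf).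
apply: (at_cut_imp (rep_horner p x)); apply: at_cut_mono (rep_cst 0) => s r0.
by rewrite /horner => -> -> [_ ->]; rewrite r0.
Qed.

HB.instance Definition _ := Num.RealField_isClosed.Build germ germ_ivt.

Lemma Dfint_dfun (F : Defs.fsym L) (ts : 'I_(farity F) -> germ) :
  Dfun S (fun s => fint S (fun j => rep (ts j) s)).
Proof.
apply: (@Dfint _ _ _ F (fun j x => rep (ts j) (x 0%N))) => j.
by apply: Dapp; [exact: dfunP|exact: Dvar].
Qed.

Definition germ_structure : structure L germ := @Structure L germ
  (fun F ts => mk (DFun (Dfint_dfun ts)))
  (fun R ts => at_cut C (fun s => rint S (fun j => rep (ts j) s))).
Local Notation S' := germ_structure.

(** A filter is closed under finite intersections, which matches the finite arities of the
    symbols. *)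
Lemma at_cut_all k (P : 'I_k -> set M) : (forall j, at_cut C (P j)) ->
  at_cut C (fun s => forall j, P j s).
Proof.
elim: k P => [|k IH] P h; first by apply: at_cutT => // s [].
apply: at_cut_mono (at_cutI pC (h ord0) (IH _ (fun j => h (lift ord0 j)))).
by move=> s [h0 hl] j; case: (unliftP ord0 j) => [i|] ->.
Qed.

Lemma rep_eval (sigma : nat -> D) t :
  at_cut C (fun s => rep (Defs.eval S' (fun i => mk (sigma i)) t) s
                     = Defs.eval S (fun i => sigma i s) t).
Proof.
elim: t => /=.
- by move=> i; exact: rep_mk.
- exact: rep_cst.
- exact: rep_cst.
- move=> t h; apply: (at_cut_imp h).
  by apply: at_cut_mono (rep_opp (Defs.eval S' (fun i => mk (sigma i)) t)) => s -> ->.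
- move=> t ht u hu; apply: (at_cut_imp ht); apply: (at_cut_imp hu).
  apply: at_cut_mono (rep_add (Defs.eval S' (fun i => mk (sigma i)) t)
    (Defs.eval S' (fun i => mk (sigma i)) u)) => s.
  by move=> -> -> ->.
- move=> t ht u hu; apply: (at_cut_imp ht); apply: (at_cut_imp hu).
  apply: at_cut_mono (rep_mul (Defs.eval S' (fun i => mk (sigma i)) t)
    (Defs.eval S' (fun i => mk (sigma i)) u)) => s.
  by move=> -> -> ->.
- move=> F ts IH; apply: (at_cut_imp (at_cut_all IH)).
  apply: at_cut_mono (rep_mk (DFun (Dfint_dfun
    (fun j => Defs.eval S' (fun i => mk (sigma i)) (ts j))))) => s -> /= h.
  by congr (fint _ _); apply: funext.
Qed.

Lemma Dset_sat phi (sigma : nat -> D) :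
  Dset S (fun s => sat S (fun i => sigma i s) phi).
Proof.
apply: (@Dsat _ _ _ phi (fun i x => sigma i (x 0%N))) => i.
by apply: Dapp; [exact: dfunP|exact: Dvar].
Qed.

(* Los's theorem: in place of the axiom of choice, the existential step uses
   definable choice. *)
Lemma los phi (sigma : nat -> D) : sat S' (fun i => mk (sigma i)) phi <->
  at_cut C (fun s => sat S (fun i => sigma i s) phi).
Proof.
elim: phi sigma => [t u|t u|R ts|phi IH|phi IH1 psi IH2|i phi IH] sigma /=.
- split=> [e|e].
    have := rep_eval sigma t; rewrite e => h; apply: (at_cut_imp h).
    by apply: at_cut_mono (rep_eval sigma u) => s ->.
  apply: germP; apply: (at_cut_imp e); apply: (at_cut_imp (rep_eval sigma t)).
  by apply: at_cut_mono (rep_eval sigma u) => s -> ->.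
- split=> [/asboolP e|e]; last apply/asboolP.
    apply: (at_cut_imp e); apply: (at_cut_imp (rep_eval sigma t)).
    by apply: at_cut_mono (rep_eval sigma u) => s -> ->.
  apply: (at_cut_imp e); apply: (at_cut_imp (rep_eval sigma t)).
  by apply: at_cut_mono (rep_eval sigma u) => s -> ->.
- have h := at_cut_all (fun j => rep_eval sigma (ts j)).
  split=> e; apply: (at_cut_imp e); apply: at_cut_mono h => s h.
    by under eq_fun do rewrite h.
  by under [in X in _ -> X]eq_fun do rewrite h.
- rewrite IH; split=> [n|n y]; last exact: at_cutN pC y n.
  exact: (at_cutNE omin pC (Dset_sat phi sigma)).
- rewrite IH1 IH2; split=> [[]|h]; first exact: at_cutI.
  by split; apply: at_cut_mono h => s [].
pose upd f j := if j == i then f else sigma j.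
have updE f s v : f s = v ->
    (fun j => upd f j s) = (fun j => if j == i then v else sigma j s).
  by move=> <-; apply: funext => j; rewrite /upd; case: eqP.
have mk_upd f : (fun j => mk (upd f j)) =
    (fun j => if j == i then mk f else mk (sigma j)).
  by apply: funext => j; rewrite /upd; case: eqP.
split=> [[v]|h].
  rewrite -[v]repK -mk_upd IH; apply: at_cut_mono => s.
  by rewrite (updE _ _ (rep v s)) // => h; exists (rep v s).
have [|f df fP] := @Dchoice _ _ S omin
  (fun s v => sat S (fun j => if j == i then v else sigma j s) phi).
  apply: (@Dsat _ _ _ phi (fun j x => if j == i then x 1%N else sigma j (x 0%N))).
  move=> j; case: eqP => _; first exact: Dvar.
  by apply: Dapp; [exact: dfunP|exact: Dvar].
exists (mk (DFun df)); rewrite -mk_upd IH; apply: at_cut_mono h => s /fP.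
by rewrite (updE _ _ (f s)).
Qed.

Lemma germ_elementary : elementary S S' gcst.
Proof.
move=> phi e; rewrite (los phi (fun i => DFun (Dcst_dfun (e i)))) /=.
split=> [h|h]; first exact: at_cutT.
by have [] := at_cut_ex pC h.
Qed.

Lemma germ_models (T : set (formula L)) : models S T -> models S' T.
Proof.
move=> ST phi Tphi e.
have -> : e = (fun i => mk (rep (e i))) by apply: funext => i; rewrite repK.
by apply/los; apply: at_cutT => // s; exact: ST.
Qed.

Lemma dense_complete_no_gap (T : set (formula L)) :
  models S T -> dense_complete T S -> cauchy_cut C -> ~ gap C.
Proof.
move=> ST dcT cC gC; have [_ Cmax _] := gC.
have [x y xy|x /mk_eq[d [e [Cd Ce h]]]] := dcT germ S' gcst
  (germ_models ST) germ_elementary _ (mk (DFun Did_dfun)).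
  have [c hc] := constant_between_at_gap omin gC cC (dfunP (rep x))
    (dfunP (rep y)) (asboolW xy).
  exists c; split; apply/asboolP; apply: (at_cut_imp hc);
  by apply: at_cut_mono (rep_cst c) => s -> [].
(* The identity would be constant on (d, e); as [C] has no largest element, that interval contains
   two distinct points of [C]. *)
have [d' Cd' dd'] := Cmax _ Cd; have [d'' Cd'' dd''] := Cmax _ Cd'.
have /= xd' := h d' dd' (cut_lt_out pC Cd' Ce).
have /= xd'' := h d'' (lt_trans dd' dd'') (cut_lt_out pC Cd'' Ce).
by rewrite -xd' -xd'' ltxx in dd''.
Qed.

End Germs.

(** The conclusion leaves open on which side [x] lies, which covers both a largest element of [C]
    and a least element of its complement; without either, [C] is a gap. *)
Theorem dense_complete_cauchy (L : language) (T : set (formula L)) (M : rcfType)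
    (S : structure L M) (C : set M) :
  o_minimal S -> models S T -> dense_complete T S ->
  proper_cut C -> cauchy_cut C ->
  exists x, (forall y, y < x -> C y) /\ (forall y, x < y -> ~ C y).
Proof.
move=> omin ST dcT pC cC; apply: contrapT => hn.
have [_ _ dC] := pC.
apply: (dense_complete_no_gap omin pC ST dcT cC); split=> // x Cx.
  apply: contrapT => nx; apply: hn; exists x; split=> [y yx|y xy Cy].
    exact: dC Cx (ltW yx).
  by apply: nx; exists y.
apply: contrapT => nx; apply: hn; exists x; split=> [y yx|y xy Cy].
  by apply: contrapT => Cy; apply: nx; exists y.
by apply: Cx; exact: dC Cy (ltW xy).
Qed.

(** * Hausdorff distance and coordinates *)

Section Cuts.
Variable M : rcfType.
Implicit Types (Z : set M) (e u l : M).

Lemma cut_closure_sub Z l : 0 <= l -> Z l -> cut_closure Z l.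
Proof. by move=> l0 Zl; split=> // u [_]; apply. Qed.

Lemma cut_closure_le Z u l : 0 <= u -> (forall z, Z z -> z <= u) ->
  cut_closure Z l -> l <= u.
Proof. by move=> u0 Zu [_]; apply. Qed.

Lemma cut_ofP g l : 0 <= g -> (cut_of g : set M) l <-> 0 <= l <= g.
Proof.
move=> g0; split=> [h|/andP[l0 lg]].
  by rewrite h.1; apply: cut_closure_le h => // z ->.
by split=> // u [_ /(_ g erefl)]; exact: le_trans.
Qed.

(** Strictness between cuts is witnessed inside [M]: if no nonnegative [u < e] bounded [Z], every
    nonnegative upper bound would be at least [e], and the closure of [Z] would contain all of
    [0, e]. *)
Lemma cut_lt_of Z e : 0 <= e -> cut_lt (mk_cut Z) (cut_of e) <->
  exists u, [/\ 0 <= u, u < e & forall z, Z z -> z <= u].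
Proof.
move=> e0; split=> [[sub nsub]|[u [u0 ue Zu]]].
  apply: contrapT => nu; apply: nsub => l /(cut_ofP _ e0)/andP[l0 le].
  split=> // u [u0 Zu]; rewrite leNgt; apply/negP => ul.
  by apply: nu; exists u; split=> //; exact: lt_le_trans ul le.
have h l : cut_closure Z l -> l <= u by exact: cut_closure_le.
split=> [l lZ|sub].
  by apply/(cut_ofP _ e0); rewrite lZ.1 (le_trans (h _ lZ) (ltW ue)).
have /sub/h : cut_set (cut_of e) e by apply/(cut_ofP _ e0); rewrite e0 lexx.
by rewrite leNgt ue.
Qed.

Variable n : nat.
Implicit Types X Y W : set 'rV[M]_n.

Lemma dist_ge0 (x y : 'rV[M]_n) : 0 <= dist x y.
Proof. exact: normr_ge0. Qed.

Lemma distC (x y : 'rV[M]_n) : dist x y = dist y x.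
Proof. exact: distrC. Qed.

Lemma dist_triangle (y x z : 'rV[M]_n) : dist x z <= dist x y + dist y z.
Proof. exact: ler_distD. Qed.

Lemma dist_le (x y : 'rV[M]_n) e : 0 <= e ->
  dist x y <= e <-> forall i, `|x 0 i - y 0 i| <= e.
Proof.
move=> e0; rewrite /dist [`|_|]mx_normrE; split=> [/bigmax_leP[_ h] i|h].
  by have := h (0, i) isT; rewrite /= !mxE.
by apply/bigmax_leP; split=> // -[j i] _ /=; rewrite ord1 !mxE.
Qed.

Definition covers e X Y := forall x, X x -> exists2 y, Y y & dist x y < e.

(** If all points of [Y] were at distance at least [e] from [x], then [e] would belong to the
    infimum cut, whose elements are at most some [u < e]. *)
Lemma hausdorff_lt e X Y : 0 < e -> cut_lt (hausdorff X Y) (cut_of e) ->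
  covers e X Y /\ covers e Y X.
Proof.
move=> e0 /(cut_lt_of _ (ltW e0))[u [u0 ue hu]].
pose I (g : 'rV[M]_n -> M) Y := cut_inf [set cut_of (g y) | y in Y].
have key (g : 'rV[M]_n -> M) W : (forall y, 0 <= g y) ->
    (forall l, (I g W : set M) l -> l <= u) -> exists2 y, W y & g y < e.
  move=> g0 h; apply: contrapT => nZ.
  suff: e <= u by rewrite leNgt ue.
  apply: h; apply: cut_closure_sub; first exact: ltW.
  split; first exact: ltW.
  move=> _ [y Zy <-]; apply/cut_ofP => //; rewrite ltW //= leNgt.
  by apply/negP => ye; apply: nZ; exists y.
split=> x Xx.
  apply: key => [y|l hl]; first exact: dist_ge0.
  apply: hu; left; apply: cut_closure_sub; first by case: hl.
  by exists (I (dist x) Y) => //; exists x.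
have [|l hl|y Xy yx] := key (fun y => dist y x) X.
- by move=> y; exact: dist_ge0.
- apply: hu; right; apply: cut_closure_sub; first by case: hl.
  by exists (I (fun y => dist y x) X) => //; exists x.
- by exists y => //; rewrite distC.
Qed.

(** Distances below [e'] only bound their supremum by [e'] itself; the slack between [e'] and [e]
    restores strictness. *)
Lemma lt_hausdorff e' e X Y : 0 <= e' -> e' < e -> covers e' X Y ->
  covers e' Y X -> cut_lt (hausdorff X Y) (cut_of e).
Proof.
move=> e'0 e'e XY YX; apply/cut_lt_of; first exact: le_trans (ltW e'e).
exists e'; split=> // l; have key (g : 'rV[M]_n -> M) W :
    (forall y, 0 <= g y) -> (exists2 y, W y & g y < e') ->
    forall l, (cut_inf [set cut_of (g y) | y in W] : set M) l -> l <= e'.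
  move=> g0 [y Zy gy] l'; apply: cut_closure_le => // z [z0 hz].
  have /(cut_ofP _ (g0 y))/andP[_ zg] := hz (cut_of (g y)) (ex_intro2 _ _ y Zy erefl).
  exact: le_trans zg (ltW gy).
case; apply: cut_closure_le => // z [_ [x Xx <-]]; apply: key.
- by move=> y; exact: dist_ge0.
- exact: XY.
- by move=> y; exact: dist_ge0.
- by have [y Yy xy] := YX x Xx; exists y => //; rewrite distC.
Qed.

End Cuts.

Section Coordinates.
Variable M : rcfType.

Lemma PiE k n (x : 'rV[M]_n) (j : 'I_k) (i : 'I_n) : val j = val i ->
  Pi k x 0 j = x 0 i.
Proof. by move=> ji; rewrite mxE ji valK. Qed.

Definition extend k (y : 'rV[M]_k) (t : M) : 'rV[M]_k.+1 :=
  \row_i (if (insub (val i) : option 'I_k) is Some j then y 0 j else t).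

Lemma Pi_extend k (y : 'rV[M]_k) t : Pi k (extend y t) = y.
Proof.
apply/rowP => i; rewrite (@PiE _ _ _ i (widen_ord (leqnSn k) i)) // mxE /=.
by rewrite valK.
Qed.

Lemma lastc_extend k (y : 'rV[M]_k) t : lastc (extend y t) = t.
Proof. by rewrite /lastc mxE insubF //= ltnn. Qed.

Lemma coordP k (P : M -> M -> Prop) (z w : 'rV[M]_k.+1) :
  (forall i, P (z 0 i) (w 0 i)) <->
  (forall i, P (Pi k z 0 i) (Pi k w 0 i)) /\ P (lastc z) (lastc w).
Proof.
split=> [h|[h hl] i].
  by split=> [i|]; [|exact: h]; rewrite !(@PiE _ _ _ i (widen_ord (leqnSn k) i)).
have [ik|ki] := ltnP i k.
  by have := h (Ordinal ik); rewrite !(@PiE _ _ _ (Ordinal ik) i).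
suff -> : i = ord_max by [].
by apply/val_inj/eqP; rewrite eqn_leq ki -ltnS ltn_ord.
Qed.

Lemma extendK k (z : 'rV[M]_k.+1) : extend (Pi k z) (lastc z) = z.
Proof.
apply/rowP; apply/(coordP (fun u v => u = v)); rewrite lastc_extend.
by split=> // i; rewrite Pi_extend.
Qed.

Lemma dist_succ k (z w : 'rV[M]_k.+1) e : 0 <= e ->
  dist z w <= e <-> dist (Pi k z) (Pi k w) <= e /\ `|lastc z - lastc w| <= e.
Proof.
by move=> e0; rewrite !dist_le // (coordP (fun u v => `|u - v| <= e)).
Qed.

Lemma dist_Pi k (z w : 'rV[M]_k.+1) : dist (Pi k z) (Pi k w) <= dist z w.
Proof. by have [|[]] := (dist_succ z w (dist_ge0 z w)).1. Qed.

Lemma dist_lastc k (z w : 'rV[M]_k.+1) : `|lastc z - lastc w| <= dist z w.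
Proof. by have [|[]] := (dist_succ z w (dist_ge0 z w)).1. Qed.

Lemma dist_Pi_le k n (z w : 'rV[M]_n) : (k <= n)%N ->
  dist (Pi k z) (Pi k w) <= dist z w.
Proof.
move=> kn; apply/dist_le; first exact: dist_ge0.
move=> i; rewrite !(@PiE _ _ _ i (widen_ord kn i)) //.
exact: (dist_le z w (dist_ge0 z w)).1.
Qed.

Lemma Pi_id n (z : 'rV[M]_n) : Pi n z = z.
Proof. by apply/rowP => i; rewrite mxE valK. Qed.

Lemma Pi_Pi k l n (z : 'rV[M]_n) : (k <= l)%N -> Pi k (Pi l z) = Pi k z.
Proof.
move=> kl; apply/rowP => i; rewrite (@PiE _ _ _ i (widen_ord kl i)) //.
by rewrite !mxE.
Qed.

End Coordinates.

(** * Limits of Lipschitz layers *)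

Section Limits.
Variable M : rcfType.
Hypothesis complete : forall C : set M, proper_cut C -> cauchy_cut C ->
  exists x, (forall y, y < x -> C y) /\ (forall y, x < y -> ~ C y).
Variables (d : Order.disp_t) (I : orderType d).
Hypothesis nomax : forall c : I, exists i, (c < i)%O.
Variable lam : M.
Hypothesis lam0 : 0 < lam.

(** One direction of covering is recorded, since [i] and [j] can be exchanged. *)
Definition set_cauchy k (E : I -> set 'rV[M]_k) := forall e, 0 < e ->
  exists c, forall i j, (c < i)%O -> (c < j)%O -> covers e (E i) (E j).

Definition set_cvg k (E : I -> set 'rV[M]_k) (B : set 'rV[M]_k) :=
  forall e, 0 < e -> exists c, forall i, (c < i)%O ->
    covers e (E i) B /\ covers e B (E i).

Lemma hausdorff_cauchy_set k (E : I -> set 'rV[M]_k) :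
  hausdorff_cauchy E -> set_cauchy E.
Proof.
move=> h e e0; have [c hc] := h e e0; exists c => i j ci cj.
by have [] := hausdorff_lt e0 (hc i j ci cj).
Qed.

Lemma set_cvg_hausdorff k (E : I -> set 'rV[M]_k) B :
  set_cvg E B -> hausdorff_cvg E B.
Proof.
move=> h e e0; have [|c hc] := h (e / 2); first lra.
exists c => i /hc[EB BE]; apply: (@lt_hausdorff _ _ (e / 2)) => //; lra.
Qed.

Definition lip k (U : set 'rV[M]_k) (f : 'rV[M]_k -> M) :=
  forall x y, U x -> U y -> `|f x - f y| <= lam * dist x y.

Lemma lipP k (U : set 'rV[M]_k) f :
  lam.-lipschitz_U (f : _ -> M^o) <-> lip U f.
Proof.
by split=> [h x y Ux Uy|h [x y] [/= Ux Uy]]; [exact: (h (x, y))|exact: h].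
Qed.

Lemma lipN k (U : set 'rV[M]_k) f : lip U f -> lip U (fun x => - f x).
Proof. by move=> h x y Ux Uy; rewrite -opprD normrN; exact: h. Qed.

(** Uniform convergence for functions with different domains: [E i] and [B] may be disjoint, so
    values are compared at points closer than an [r] that serves all of them. *)
Definition unif_cvg k (E : I -> set 'rV[M]_k) (F : I -> 'rV[M]_k -> M)
    (B : set 'rV[M]_k) (f : 'rV[M]_k -> M) :=
  forall e, 0 < e -> exists2 r, 0 < r & exists c, forall i, (c < i)%O ->
    forall y x, E i y -> B x -> dist x y < r -> `|F i y - f x| <= e.

Lemma near_point k (E : I -> set 'rV[M]_k) B x r c : set_cvg E B -> B x ->
  0 < r -> exists i y, [/\ (c < i)%O, E i y & dist x y < r].
Proof.
move=> EB Bx r0; have [c' hc'] := EB r r0.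
have [i ci] := nomax (Order.max c c').
move: ci; rewrite gt_max => /andP[ci ci'].
by have [y Ey xy] := (hc' i ci').2 x Bx; exists i, y.
Qed.

(* One-sided closeness suffices: exchanging the roles of i and j gives the
   other inequality. *)
Lemma limit_function k (E : I -> set 'rV[M]_k) B F :
  set_cvg E B -> (forall i, lip (E i) (F i)) ->
  (forall e, 0 < e -> exists c, forall i j, (c < i)%O -> (c < j)%O ->
     forall y, E i y -> exists2 z, E j z /\ F j z < F i y + e & dist y z < e) ->
  exists2 f, lip B f & unif_cvg E F B f.
Proof.
move: lam0 => lam_gt0 EB Flip Fcau.
have key e : 0 < e -> exists2 r, 0 < r & exists c, forall i j, (c < i)%O ->
    (c < j)%O -> forall y z, E i y -> E j z -> dist y z < r ->
    `|F i y - F j z| <= e.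
  (* The hypothesis costs r in the value at a point y' within r of y. Moving from y' to z, at
     distance at most 2r, costs 2 lam r; together this is e. *)
  move=> e0; set r := e / (1 + 2 * lam).
  have r0 : 0 < r by apply: divr_gt0 => //; lra.
  have rE : r + lam * (2 * r) = e by rewrite /r; field; lra.
  exists r => //; have [c hc] := Fcau r r0; exists c.
  suff half i j : (c < i)%O -> (c < j)%O -> forall y z, E i y -> E j z ->
      dist y z < r -> F j z <= F i y + e.
    move=> i j ci cj y z Ey Ez yz; rewrite ler_distl.
    have := half i j ci cj y z Ey Ez yz.
    by have := half j i cj ci z y Ez Ey; rewrite distC => /(_ yz); lra.
  move=> ci cj y z Ey Ez yz; have [y' [Ey' Fy'] yy'] := hc i j ci cj y Ey.
  have := Flip j y' z Ey' Ez; rewrite ler_distl => /andP[F1 F2].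
  have : lam * dist y' z <= lam * (2 * r).
    rewrite ler_pM2l //; have := dist_triangle y y' z.
    by rewrite (distC y' y); lra.
  lra.
pose lim x l := forall e, 0 < e -> exists2 r, 0 < r & exists c, forall i,
  (c < i)%O -> forall y, E i y -> dist x y < r -> `|F i y - l| <= e.
have limE x : B x -> exists l, lim x l.
  move=> Bx.
  (* The lower limit of the values near [x], as a cut; by [osc] it lies within [e] of each late
     nearby value, so it is a Cauchy cut. *)
  pose C := [set t | exists2 r, 0 < r & exists c, forall i, (c < i)%O ->
    forall y, E i y -> dist x y < r -> t < F i y].
  have osc e : 0 < e -> exists2 r, 0 < r & exists c, forall i, (c < i)%O ->
      forall y, E i y -> dist x y < r -> C (F i y - e) /\ ~ C (F i y + e).
    move=> e0; have [|r r0 [c hc]] := key (e / 2); first lra.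
    exists (r / 2); first lra.
    exists c => i ci y Ey xy.
    have close j z : (c < j)%O -> E j z -> dist x z < r / 2 ->
        `|F i y - F j z| <= e / 2.
      move=> cj Ez xz; apply: hc => //.
      by have := dist_triangle x y z; rewrite (distC y x); lra.
    split.
      exists (r / 2); first lra.
      exists c => j cj z Ez xz; have := close j z cj Ez xz.
      by rewrite ler_distl; lra.
    move=> [r' r'0 [c' hc']].
    have [|j [z [cj Ez xz]]] := @near_point k E B x
      (Num.min r' (r / 2)) (Order.max c c') EB Bx.
      by rewrite lt_min r'0; lra.
    move: cj xz; rewrite gt_max lt_min => /andP[cj cj'] /andP[xz xz'].
    have := close j z cj Ez xz'; have := hc' j cj' z Ez xz.
    by rewrite ler_distl; lra.
  have dC u v : C v -> u <= v -> C u.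
    move=> [r r0 [c hc]] uv; exists r => //; exists c => i ci y Ey xy.
    by apply: le_lt_trans uv _; exact: hc.
  have ex e : 0 < e -> exists v, C (v - e) /\ ~ C (v + e).
    move=> /osc[r r0 [c hc]].
    have [i [y [ci Ey xy]]] := near_point c EB Bx r0.
    by exists (F i y); exact: hc.
  have pC : proper_cut C.
    have [v [Cv nCv]] := ex 1 ltr01.
    by split; [exists (v - 1)|exists (v + 1)|].
  have [|l [l1 l2]] := complete pC.
    move=> e e0; have [|v [Cv nCv]] := ex (e / 4); first lra.
    by exists (v - e / 4), (v + e / 4); split=> //; lra.
  exists l => e e0; have [r r0 [c hc]] := osc e e0; exists r => //; exists c.
  move=> i ci y Ey xy; have [C1 C2] := hc i ci y Ey xy.
  rewrite ler_distl; apply/andP; split; rewrite leNgt; apply/negP => h.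
    by apply: C2; apply: l1; lra.
  by apply: (l2 (F i y - e)) => //; lra.
pose f x := xget 0 [set l | lim x l].
have fP x : B x -> lim x (f x).
  by move=> /limE[l hl]; rewrite /f; case: xgetP => [y -> //|/(_ l)].
(* The limit at [x] has a radius and an index depending on [x]. Passing through one late point [z]
   very near [x] replaces them by those of [key]. *)
have Ff : unif_cvg E F B f.
  move=> e e0; have [|r r0 [c hc]] := key (e / 2); first lra.
  exists (r / 2); first lra.
  exists c => i ci y x Ey Bx xy.
  have [|r' r'0 [c' hc']] := fP x Bx (e / 2); first lra.
  have [|j [z [cj Ez xz]]] := @near_point k E B x
      (Num.min r' (r / 2)) (Order.max c c') EB Bx.
    by rewrite lt_min r'0; lra.
  move: cj xz; rewrite gt_max lt_min => /andP[cj cj'] /andP[xz xz'].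
  have := hc' j cj' z Ez xz.
  have : dist y z < r by have := dist_triangle x y z; rewrite (distC y x); lra.
  move=> /(hc i j ci cj y z Ey Ez); rewrite !ler_distl; lra.
exists f => // x x' Bx Bx'; apply/ler_addgt0Pr => e e0.
(* The approximants y, y' of x, x' cost s each in value and at most 2s in distance, that is 2s + 2
   lam s = e in all. *)
pose s := e / (2 + 2 * lam).
have s0 : 0 < s by apply: divr_gt0 => //; lra.
have sE : 2 * s + lam * (2 * s) = e by rewrite /s; field; lra.
have [r r0 [c hc]] := Ff s s0.
have [|c' hc'] := EB (Num.min r s); first by rewrite lt_min r0.
have [i] := nomax (Order.max c c'); rewrite gt_max => /andP[ci ci'].
have [y Ey] := (hc' i ci').2 x Bx; rewrite lt_min => /andP[xy xys].
have [y' Ey'] := (hc' i ci').2 x' Bx'; rewrite lt_min => /andP[xy' xys'].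
have := hc i ci y x Ey Bx xy; have := hc i ci y' x' Ey' Bx' xy'.
have := Flip i y y' Ey Ey'; rewrite !ler_distl.
have : lam * dist y y' <= lam * (dist x x' + 2 * s).
  rewrite ler_pM2l //; have := dist_triangle x y y'.
  by have := dist_triangle x' x y'; rewrite (distC y x); lra.
rewrite mulrDr; lra.
Qed.

(** Graphs and bands are treated alike, as families of subsets of the line: convergence of the base
    and uniform closeness of the line sets over nearby base points give convergence of the total
    sets. *)
Lemma cvg_layer k (E : I -> set 'rV[M]_k) B
    (P : I -> 'rV[M]_k -> M -> Prop) (Q : 'rV[M]_k -> M -> Prop) :
  set_cvg E B ->
  (forall e, 0 < e -> exists2 r, 0 < r & exists c, forall i, (c < i)%O ->
    forall y x, E i y -> B x -> dist x y < r ->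
      (forall t, P i y t -> exists2 s, Q x s & `|t - s| <= e) /\
      (forall t, Q x t -> exists2 s, P i y s & `|t - s| <= e)) ->
  set_cvg (fun i => [set z : 'rV[M]_k.+1 | E i (Pi k z) /\ P i (Pi k z) (lastc z)])
    [set z : 'rV[M]_k.+1 | B (Pi k z) /\ Q (Pi k z) (lastc z)].
Proof.
move=> EB PQ e e0; have [|r r0 [c hc]] := PQ (e / 2); first lra.
have [|c' hc'] := EB (Num.min r (e / 2)); first by rewrite lt_min r0; lra.
exists (Order.max c c') => i; rewrite gt_max => /andP[ci ci'].
have [EBi BEi] := hc' i ci'.
split=> z [/= zE zP].
  have [x Bx] := EBi _ zE; rewrite lt_min => /andP[xr xe].
  have [+ _] := hc i ci _ x zE Bx ltac:(by rewrite distC).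
  move=> /(_ _ zP)[s Qs ts]; exists (extend x s).
    by rewrite /= Pi_extend lastc_extend.
  apply: (@le_lt_trans _ _ (e / 2)); last lra.
  by apply/dist_succ; [lra|rewrite Pi_extend lastc_extend; split=> //; exact: ltW].
have [y Ey] := BEi _ zE; rewrite lt_min => /andP[xr xe].
have [_ +] := hc i ci y _ Ey zE xr.
move=> /(_ _ zP)[s Ps ts]; exists (extend y s).
  by rewrite /= Pi_extend lastc_extend.
apply: (@le_lt_trans _ _ (e / 2)); last lra.
by apply/dist_succ; [lra|rewrite Pi_extend lastc_extend; split=> //; exact: ltW].
Qed.

Lemma graph_limit k (E : I -> set 'rV[M]_k) B F :
  set_cvg E B -> (forall i, lip (E i) (F i)) ->
  set_cauchy (fun i => graph (E i) (F i)) ->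
  exists2 f, lip B f & set_cvg (fun i => graph (E i) (F i)) (graph B f).
Proof.
move=> EB Flip Fcau; have [//|//|e e0|f flip Ff] := @limit_function k E B F.
  have [c hc] := Fcau e e0; exists c => i j ci cj y Ey.
  have [|w [Ew wF] yw] := hc i j ci cj (extend y (F i y)).
    by rewrite /graph /= Pi_extend lastc_extend.
  exists (Pi k w).
    split=> //; rewrite -wF; have := dist_lastc (extend y (F i y)) w.
    by rewrite lastc_extend ler_distl; lra.
  have := dist_Pi (extend y (F i y)) w.
  by rewrite Pi_extend => /le_lt_trans; apply.
exists f => //; apply: (@cvg_layer k E B
  (fun i y t => t = F i y) (fun x t => t = f x)) => // e e0.
have [r r0 [c hc]] := Ff e e0; exists r => //; exists c => i ci y x Ey Bx xy.
have := hc i ci y x Ey Bx xy => h.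
split=> _ ->; [exists (f x)|exists (F i y)] => //.
by rewrite distrC.
Qed.

Lemma band_limit k (E : I -> set 'rV[M]_k) B F G :
  set_cvg E B -> (forall i, lip (E i) (F i)) -> (forall i, lip (E i) (G i)) ->
  (forall i y, E i y -> F i y < G i y) ->
  set_cauchy (fun i => band (E i) (Some (F i)) (Some (G i))) ->
  exists f g, [/\ lip B f, lip B g, forall x, B x -> f x <= g x &
    set_cvg (fun i => band (E i) (Some (F i)) (Some (G i))) (closed_band B f g)].
Proof.
move=> EB Flip Glip FG FGcau.
(* The boundary is not in the band; [F i y + r] and [G i y - r] are heights inside it, as close to
   the boundary as required. *)
have thin (e : M) i y : 0 < e -> E i y -> exists r, [/\ 0 < r, r < e & r < G i y - F i y].
  move=> e0 Ey; have FGi := FG i y Ey; exists (Num.min (e / 2) ((G i y - F i y) / 2)).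
  by split; [rewrite lt_min; lra|rewrite gt_min; lra..].
have step (e : M) j t y :
    (exists2 w, band (E j) (Some (F j)) (Some (G j)) w &
       dist (extend y t) w < e) ->
    exists2 z, [/\ E j z, F j z < t + e & t - e < G j z] & dist y z < e.
  move=> [w [/= wE Fw Gw] yw]; exists (Pi k w).
    have := le_lt_trans (dist_lastc (extend y t) w) yw.
    by rewrite lastc_extend ltr_distl => /andP[? ?]; split=> //; lra.
  have := dist_Pi (extend y t) w.
  by rewrite Pi_extend => /le_lt_trans; apply.
have [//|//|e e0|f flip Ff] := @limit_function k E B F.
  have [|c hc] := FGcau (e / 2); first lra.
  exists c => i j ci cj y Ey.
  have [|r [r0 re rFG]] := thin (e / 2) i y _ Ey; first lra.
  have [|z [Ez Fz Gz] yz] := step (e / 2) j (F i y + r) y.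
    apply: (hc i j ci cj); rewrite /band /= Pi_extend lastc_extend.
    by split=> //; lra.
  by exists z; [split=> //; lra|lra].
(* [limit_function] asks for upper estimates. A band point near the top boundary bounds [G j z] from
   below, hence the change of sign. *)
have [//| |e e0|g' glip Gg] := @limit_function k E B (fun i y => - G i y).
- by move=> i; exact: lipN.
- have [|c hc] := FGcau (e / 2); first lra.
  exists c => i j ci cj y Ey.
  have [|r [r0 re rFG]] := thin (e / 2) i y _ Ey; first lra.
  have [|z [Ez Fz Gz] yz] := step (e / 2) j (G i y - r) y.
    apply: (hc i j ci cj); rewrite /band /= Pi_extend lastc_extend.
    by split=> //; lra.
  by exists z; [split=> //; lra|lra].
have fg : forall e, 0 < e -> exists2 r, 0 < r & exists c, forall i, (c < i)%O ->
    forall y x, E i y -> B x -> dist x y < r ->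
    [/\ F i y - e <= f x, f x <= F i y + e, G i y - e <= - g' x & - g' x <= G i y + e].
  move=> e e0; have [r r0 [c hc]] := Ff e e0; have [r' r'0 [c' hc']] := Gg e e0.
  exists (Num.min r r'); first by rewrite lt_min r0.
  exists (Order.max c c') => i; rewrite gt_max => /andP[ci ci'] y x Ey Bx.
  rewrite lt_min => /andP[xy xy'].
  have := hc i ci y x Ey Bx xy; have := hc' i ci' y x Ey Bx xy'.
  by rewrite !ler_distl; split; lra.
have fle x : B x -> f x <= - g' x.
  move=> Bx; apply/ler_addgt0Pr => e e0.
  have [|r r0 [c hc]] := fg (e / 2); first lra.
  have [i [y [ci Ey xy]]] := near_point c EB Bx r0.
  have [? ? ? ?] := hc i ci y x Ey Bx xy; have := FG i y Ey; lra.
exists f, (fun x => - g' x); split=> //; first exact: lipN.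
have bandE : (fun i => band (E i) (Some (F i)) (Some (G i))) =
   (fun i => [set z : 'rV[M]_k.+1 | E i (Pi k z) /\
      (F i (Pi k z) < lastc z /\ lastc z < G i (Pi k z))]).
  by apply: funext => i; apply/seteqP; split=> z [] /=; [|move=> ? []].
rewrite bandE.
apply: (@cvg_layer k E B (fun i y t => F i y < t /\ t < G i y)
  (fun x t => f x <= t <= - g' x)) => // e e0.
have [|r r0 [c hc]] := fg (e / 2); first lra.
exists r => //; exists c => i ci y x Ey Bx xy.
have [f1 f2 g1 g2] := hc i ci y x Ey Bx xy; have FGi := FG i y Ey.
have [|s [s0 se sFG]] := thin (e / 2) i y _ Ey; first lra.
split=> t.
  move=> [Ft tG]; have fgx := fle x Bx.
  have [tf|ft] := leP t (f x); first by exists (f x); rewrite ?ler_distl; lra.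
  have [gt|tg] := leP (- g' x) t.
    by exists (- g' x); rewrite ?ler_distl; lra.
  by exists t; [lra|rewrite subrr normr0 ltW].
move=> /andP[ft tg].
have [tF|Ft] := leP t (F i y).
  by exists (F i y + s); [split; lra|rewrite ler_distl; lra].
have [Gt|tG] := leP (G i y) t.
  by exists (G i y - s); [split; lra|rewrite ler_distl; lra].
by exists t; [split|rewrite subrr normr0 ltW].
Qed.

End Limits.

(** * Fibers of the cell *)

Section Fibers.
Variable M : rcfType.
Implicit Types m n k : nat.

Lemma norm_coord n (x : 'rV[M]_n) i : `|x 0 i| <= `|x|.
Proof.
have := (dist_le x 0 (dist_ge0 x 0)).1 (lexx _) i.
by rewrite /dist mxE !subr0.
Qed.

Lemma Pi_row_mxl m n (a : 'rV[M]_m) (z : 'rV[M]_n) : Pi m (row_mx a z) = a.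
Proof. by apply/rowP => i; rewrite (@PiE _ _ _ _ i (lshift n i)) // row_mxEl. Qed.

Lemma Pi_row_mx m n k (a : 'rV[M]_m) (z : 'rV[M]_n) : (k <= n)%N ->
  Pi (m + k) (row_mx a z) = row_mx a (Pi k z).
Proof.
move=> kn; apply/rowP => i; case: (split_ordP i) => j ->.
  by rewrite (@PiE _ _ _ _ _ (lshift n j)) // !row_mxEl.
rewrite (@PiE _ _ _ _ _ (rshift m (widen_ord kn j))) // !row_mxEr.
by rewrite (@PiE _ _ _ _ j (widen_ord kn j)).
Qed.

Lemma Pi_row_mxS m n k (a : 'rV[M]_m) (z : 'rV[M]_n) : (k < n)%N ->
  Pi (m + k).+1 (row_mx a z) = extend (row_mx a (Pi k z)) (lastc (Pi k.+1 z)).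
Proof.
move=> kn; rewrite -[LHS]extendK Pi_Pi // Pi_row_mx; last exact: ltnW.
congr (extend _ _); rewrite /lastc.
rewrite (@PiE _ _ _ _ ord_max (rshift m (Ordinal kn))) // row_mxEr.
by rewrite (@PiE _ _ _ _ ord_max (Ordinal kn)).
Qed.

Lemma row_mx_split m n (v : 'rV[M]_(m + n)) :
  exists a z, v = row_mx a z.
Proof. by exists (lsubmx v), (rsubmx v); rewrite hsubmxK. Qed.

Lemma fiber_Pi m n k (A : set 'rV[M]_(m + n)) (a : 'rV[M]_m) : (k <= n)%N ->
  fiber (Pi (m + k) @` A) a = Pi k @` fiber A a.
Proof.
move=> kn; apply/seteqP; split=> [y [v Av]|_ [z Az <-]].
  have [a' [z vE]] := row_mx_split v; rewrite vE in Av *.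
  by rewrite Pi_row_mx // => /eq_row_mx[<- <-]; exists z.
by exists (row_mx a z) => //; rewrite Pi_row_mx.
Qed.

Lemma Pi_fiber_layer m n k (A : set 'rV[M]_(m + n)) (a : 'rV[M]_m)
    (l : layer M (m + k)) (z : 'rV[M]_k.+1) : (k < n)%N ->
  Pi (m + k).+1 @` A = layer_set (Pi (m + k) @` A) l ->
  (Pi k.+1 @` fiber A a) z <->
  layer_set (Pi (m + k) @` A) l (extend (row_mx a (Pi k z)) (lastc z)).
Proof.
move=> kn <-; split=> [[z' Az' <-]|[v Av]].
  by exists (row_mx a z') => //; rewrite Pi_row_mxS // Pi_Pi.
have [a' [z' vE]] := row_mx_split v; rewrite vE in Av *.
rewrite Pi_row_mxS // => e.
have := congr1 (fun w => Pi (m + k) w) e; rewrite /= !Pi_extend.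
move=> /eq_row_mx[aE zE]; have := congr1 (@lastc _ _) e.
rewrite !lastc_extend => lE; exists z'; first by rewrite /fiber /= -aE.
by rewrite -[LHS]extendK -[RHS]extendK Pi_Pi // zE lE.
Qed.

Lemma fiber_nonempty m n (A : set 'rV[M]_(m + n)) a :
  (Pi m @` A) a -> exists z, fiber A a z.
Proof.
move=> [v Av]; have [a' [z vE]] := row_mx_split v; rewrite vE in Av *.
by rewrite Pi_row_mxl => <-; exists z.
Qed.

Lemma bounded_fiber_coord m n (A : set 'rV[M]_(m + n)) : bounded_set A ->
  exists K, forall a k z, (k < n)%N -> (Pi k.+1 @` fiber A a) z -> `|lastc z| <= K.
Proof.
move=> [K [_ AK]]; exists (K + 1) => a k _ kn [z Az <-].
apply: le_trans _ (AK _ (ltr_pwDr ltr01 (lexx K)) _ Az).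
apply: le_trans _ (norm_coord _ (rshift m (Ordinal kn))).
by rewrite row_mxEr /lastc (@PiE _ _ _ _ ord_max (Ordinal kn)).
Qed.

Variable lam : M.
Hypothesis lam0 : 0 < lam.

Lemma graph_extend k (U : set 'rV[M]_k) f y t :
  graph U f (extend y t) = (U y /\ t = f y).
Proof.
by rewrite -[LHS]/(U (Pi k (extend y t)) /\ lastc (extend y t) = f (Pi k (extend y t)))
  Pi_extend lastc_extend.
Qed.

Lemma band_extend k (U : set 'rV[M]_k) lo hi y t :
  band U lo hi (extend y t) =
  [/\ U y, if lo is Some f then f y < t else True
    & if hi is Some g then t < g y else True].
Proof.
rewrite -[LHS]/([/\ U (Pi k (extend y t)),
    if lo is Some f then f (Pi k (extend y t)) < lastc (extend y t) else True
  & if hi is Some g then lastc (extend y t) < g (Pi k (extend y t)) else True]).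
by rewrite Pi_extend lastc_extend.
Qed.

Lemma rV0_eq (x y : 'rV[M]_0) : x = y.
Proof. by apply/rowP => -[]. Qed.

Lemma rV1_coord (x : 'rV[M]_1) : lastc x = x 0 0.
Proof. by rewrite /lastc; congr (x 0 _); exact: val_inj. Qed.

(** Limit cells begin in dimension 1, whereas the presentation starts over the one-point space M^0;
    there a closed band is a closed interval. *)
Lemma limit_cell_closed_band0 (f g : 'rV[M]_0 -> M) : f 0 <= g 0 ->
  lip_limit_cell lam (closed_band setT f g).
Proof.
move=> fg; suff -> : closed_band setT f g = [set x | x 0 0 \in `[f 0, g 0]].
  by apply: Llc1; exists (f 0); rewrite /= in_itv /= lexx.
apply/seteqP; split=> x; rewrite /closed_band /= in_itv /= rV1_coord (rV0_eq (Pi 0 x) 0).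
  by case.
by split.
Qed.

Lemma limit_cell_graph0 (f : 'rV[M]_0 -> M) :
  lip_limit_cell lam (graph setT f).
Proof.
suff -> : graph setT f = closed_band setT f f.
  exact: limit_cell_closed_band0.
apply/seteqP; split=> x; rewrite /graph /closed_band /=.
  by move=> [_ ->]; rewrite lexx.
by move=> [_ /le_anti->].
Qed.

(** Serves the degenerate case of an index set with a last element, where any limit cell will do. *)
Lemma limit_cell_inhabited k : exists B : set 'rV[M]_k.+1, lip_limit_cell lam B.
Proof.
elim: k => [|k [B hB]].
  by exists (graph setT (fun _ => 0)); exact: limit_cell_graph0.
exists (graph B (fun _ => 0)); apply: LlcGraph => //; apply/lipP => x y _ _.
by rewrite subrr normr0 mulr_ge0 ?dist_ge0 // ltW.
Qed.

End Fibers.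

(** * Induction on the coordinates of the fibers *)

Section LimitCells.
Variable M : rcfType.
Hypothesis complete : forall C : set M, proper_cut C -> cauchy_cut C ->
  exists x, (forall y, y < x -> C y) /\ (forall y, x < y -> ~ C y).
Variables (d : Order.disp_t) (I : orderType d).
Hypothesis nomax : forall c : I, exists i, (c < i)%O.
Variables (lam : M) (m n : nat).
Hypothesis lam0 : 0 < lam.
Variables (L : language) (S : structure L M) (p : nat).
Variables (A : set 'rV[M]_(m + n)) (pres : forall k : nat, layer M (m + k)).
Variable (a : I -> 'rV[M]_m).
Hypothesis A_bounded : bounded_set A.
Hypothesis A_pres : presented_over S p A pres.
Hypothesis A_lip : fibers_lipschitz lam A pres.
Hypothesis aA : forall i, (Pi m @` A) (a i).
Hypothesis a_cauchy : set_cauchy (fun i => fiber A (a i)).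

Let E k i : set 'rV[M]_k := Pi k @` fiber A (a i).
Arguments E : clear implicits.

Lemma E_cauchy k : (k <= n)%N -> set_cauchy (E k).
Proof.
move=> kn e /a_cauchy[c hc]; exists c => i j ci cj _ [x Ax <-].
have [y Ay xy] := hc i j ci cj x Ax; exists (Pi k y); first by exists y.
exact: le_lt_trans (dist_Pi_le x y kn) xy.
Qed.

Lemma E_lip k h i : (k < n)%N -> finite_bounds (pres k) h ->
  lip lam (E k i) (fun y => h (row_mx (a i) y)).
Proof.
move=> kn hk; apply/lipP; have := A_lip kn (aA i) hk.
by rewrite fiber_Pi //; exact: ltnW.
Qed.

Lemma E_layer k i z : (k < n)%N -> E k.+1 i z <->
  layer_set (Pi (m + k) @` A) (pres k) (extend (row_mx (a i) (Pi k z)) (lastc z)).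
Proof. by move=> kn; apply: Pi_fiber_layer => //; exact: (A_pres kn).2. Qed.

Lemma E_row_mx k i y : (k < n)%N ->
  (Pi (m + k) @` A) (row_mx (a i) y) = E k i y.
Proof. by move=> kn; rewrite -[RHS]/(E k i y) /E -fiber_Pi // ltnW. Qed.

Lemma E_inhabited k i : exists y, E k i y.
Proof. by have [z Az] := fiber_nonempty (aA i); exists (Pi k z), z. Qed.

(** The two closure assumptions stand in for the constructors of limit cells: M^0 is not itself a
    limit cell, so the first layer and the later ones justify them differently. *)
Lemma limit_layer k (U : set 'rV[M]_k) : (k < n)%N -> set_cvg (E k) U ->
  (forall f, lip lam U f -> lip_limit_cell lam (graph U f)) ->
  (forall f g, lip lam U f -> lip lam U g -> (forall x, U x -> f x <= g x) ->
     lip_limit_cell lam (closed_band U f g)) ->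
  exists2 B, lip_limit_cell lam B & set_cvg (E k.+1) B.
Proof.
move=> kn EU gU bU; have Ecau := E_cauchy kn.
have [[hp hlay] _] := A_pres kn; have Elay := fun i z => E_layer i z kn.
have Elip := fun h i => @E_lip k h i kn.
case: (pres k) hp hlay Elay Elip => [f|lo hi] hp hlay Elay Elip.
  have EE : E k.+1 = (fun i => graph (E k i) (fun y => f (row_mx (a i) y))).
    apply: funext => i; apply/seteqP; split=> z zE.
      rewrite -(extendK z) graph_extend -E_row_mx //.
      by move/Elay: zE; rewrite -[layer_set _ _]/(graph _ _) graph_extend.
    apply/Elay; rewrite -[layer_set _ _]/(graph _ _).
    by rewrite graph_extend E_row_mx.
  rewrite EE in Ecau *.
  have [i|B' lB cB] := graph_limit complete nomax lam0 EU _ Ecau.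
    exact: Elip.
  by exists (graph U B') => //; exact: gU.
(* Infinite bounds are refuted on a single fiber; the Cauchy condition supplies an index for it. *)
have [c _] := Ecau 1 ltr01; have [i0 _] := nomax c.
have [K AK] := bounded_fiber_coord A_bounded.
have [y0 Ey0] := E_inhabited k i0.
have nE t : K < `|t| -> ~ band (Pi (m + k) @` A) lo hi
    (extend (row_mx (a i0) y0) t).
  move=> Kt h; have := AK (a i0) k (extend y0 t) kn.
  rewrite lastc_extend leNgt Kt => /(_ _)/negP; apply=> //.
  by apply/Elay; rewrite Pi_extend lastc_extend.
case: lo hi hp hlay Elay Elip nE => [f|] [g|] hp hlay Elay Elip nE.
- have EE : E k.+1 = (fun i => band (E k i) (Some (fun y => f (row_mx (a i) y)))
      (Some (fun y => g (row_mx (a i) y)))).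
    apply: funext => i; apply/seteqP; split=> z zE.
      rewrite -(extendK z) band_extend -E_row_mx //.
      by move/Elay: zE; rewrite -[layer_set _ _]/(band _ (Some f) (Some g)) band_extend.
    apply/Elay; rewrite -[layer_set _ _]/(band _ (Some f) (Some g)).
    by rewrite band_extend E_row_mx.
  rewrite EE in Ecau *.
  have [i|i|i y|F [G [lF lG FG cB]]] := band_limit complete nomax lam0 EU _ _ _ Ecau.
  + by apply: Elip; left.
  + by apply: Elip; right.
  + by rewrite -E_row_mx //; exact: hlay.
  by exists (closed_band U F G) => //; exact: bU.
(* A band without upper bound contains a point above both [f] and the bound on the coordinates; the
   absolute value is taken because the sign of [K] is not recorded. *)
- case: (nE (Num.max (f (row_mx (a i0) y0)) `|K| + 1)).
    rewrite ger0_norm; last by rewrite addr_ge0 // le_max normr_ge0 orbT.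
    by rewrite (le_lt_trans (ler_norm K)) // ltr_pwDr // le_max lexx orbT.
  rewrite band_extend E_row_mx //; split=> //.
  by rewrite ltr_pwDr // le_max lexx.
- case: (nE (- (Num.max (- g (row_mx (a i0) y0)) `|K| + 1))).
    rewrite normrN ger0_norm; last by rewrite addr_ge0 // le_max normr_ge0 orbT.
    by rewrite (le_lt_trans (ler_norm K)) // ltr_pwDr // le_max lexx orbT.
  rewrite band_extend E_row_mx //; split=> //.
  by rewrite ltrNl ltr_pwDr // le_max lexx.
- case: (nE (`|K| + 1)).
    rewrite ger0_norm; last by rewrite addr_ge0.
    by rewrite (le_lt_trans (ler_norm K)) // ltrDl.
  by rewrite band_extend E_row_mx.
Qed.

Lemma E0_cvg : set_cvg (E 0) setT.
Proof.
move=> e e0; have [c _] := a_cauchy e0; exists c => i _.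
have [y Ey] := E_inhabited 0 i.
split=> x _; [exists x|exists y] => //.
  by rewrite /dist subrr normr0.
by rewrite (rV0_eq x y) /dist subrr normr0.
Qed.

Lemma limit_cells k : (k < n)%N ->
  exists2 B, lip_limit_cell lam B & set_cvg (E k.+1) B.
Proof.
elim: k => [|k IH] kn.
  apply: (limit_layer kn E0_cvg) => [f _|f g _ _ fg].
    exact: limit_cell_graph0.
  by apply: limit_cell_closed_band0; exact: fg.
have [U cU EU] := IH (ltnW kn).
apply: (limit_layer kn EU) => [f lf|f g lf lg fg].
  by apply: LlcGraph => //; exact/lipP.
by apply: LlcBand => //; exact/lipP.
Qed.

End LimitCells.

Theorem lemma4p2 (L : language) (T : set (formula L))
  (M : rcfType) (S : structure L M)
  (d : Order.disp_t) (kappa : orderType d)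
  (p m n : nat) (lam : M)
  (A : set 'rV[M]_(m + n)) (pres : forall k : nat, layer M (m + k))
  (a : kappa -> 'rV[M]_m) :
  T `<=` @sentence L ->
  complete_theory T ->
  o_minimal_theory T ->
  models S T ->
  dense_complete T S ->
  is_coinitiality M kappa ->
  (0 < p)%N ->
  (0 < n)%N ->
  Cp_cell S p A ->
  bounded_set A ->
  presented_over S p A pres ->
  0 < lam ->
  fibers_lipschitz lam A pres ->
  (forall i : kappa, (Pi m @` A) (a i)) ->
  hausdorff_cauchy (fun i : kappa => fiber A (a i)) ->
  exists B : set 'rV[M]_n,
    lip_limit_cell lam B /\
    hausdorff_cvg (fun i : kappa => fiber A (a i)) B.
Proof.
case: n A pres => [|k] A pres _ _ omin ST dcT _ _ // _ _.
move=> A_bounded A_pres lam0 A_lip aA a_cauchy.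
have [nomax|[c cmax]] : (forall c : kappa, exists i, (c < i)%O) \/
    exists c : kappa, forall i, ~ (c < i)%O.
  have [[c hc]|h] := EM (exists c : kappa, forall i, ~ (c < i)%O).
    by right; exists c.
  left=> c; apply: contrapT => nc; apply: h; exists c => i ci; apply: nc.
  by exists i.
  have complete C := @dense_complete_cauchy _ _ _ _ C (omin _ _ ST) ST dcT.
  have [B cB EB] := limit_cells complete nomax lam0 A_bounded A_pres A_lip aA
    (hausdorff_cauchy_set a_cauchy) (ltnSn k).
  exists B; split=> //; apply: set_cvg_hausdorff.
  suff -> : (fun i => fiber A (a i)) = (fun i => Pi k.+1 @` fiber A (a i)) by [].
  apply: funext => i; apply/seteqP; split=> [z Az|_ [z Az <-]].
    by exists z => //; rewrite Pi_id.
  by rewrite Pi_id.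
(* kappa has a last element: every sequence converges to every set. *)
have [B cB] := limit_cell_inhabited lam0 k.
by exists B; split=> // e _; exists c => i /cmax.
Qed.
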